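(* Let $(V_i)_{i\ge0}$, $(A_i)_{i\ge0}$, $(B_i)_{i\ge0}$ be mutually independent sequences of i.i.d. random variables, where the $V_i$ are uniformly distributed on $[0,1]$, the $A_i$ are exponentially distributed with rate $\lambda>0$, and the $B_i$ are non-negative with finite mean and Laplace–Stieltjes transform $\Phi_B(s)=\mathbb{E}e^{-sB_0}$. Let $W_0=w\ge0$ and $W_{i+1}=[V_iW_i+B_i-A_i]^+$ for $i=0,1,\dots$. Then $W_i$ converges weakly to a proper limit $W$ as $i\to\infty$, and its Laplace–Stieltjes transform $\Phi_W(s)=\mathbb{E}e^{-sW}$ satisfies, for real $s>0$ with $s\neq\lambda$, $$\Phi_W(s)=\frac{p_\infty}{s-\lambda}\left(s-\frac{\lambda\,\Phi_B(s)}{s}\int_\lambda^s\frac{u}{u-\lambda}\exp\left(\lambda\int_u^s\frac{\Phi_B(t)}{t(\lambda-t)}\,\mathrm{d}t\right)\mathrm{d}u\right),$$ where $$p_\infty=\left[\int_0^\lambda\frac{1}{\lambda-u}\exp\left(-\int_0^u\left(\frac{\lambda\,\Phi_B(t)}{t(\lambda-t)}-\frac1t\right)\mathrm{d}t\right)\mathrm{d}u\right]^{-1}.$$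
   Context: Notation: $[x]^+=\max\{x,0\}$. A limit is proper if it is an almost surely finite random variable. For $s<\lambda$, $\int_\lambda^s=-\int_s^\lambda$. *)

(* Defs.v *)
From HB Require Import structures.
From mathcomp Require Export all_boot all_order all_algebra.
From mathcomp Require Export all_classical all_reals all_analysis.
Export Order.TTheory GRing.Theory Num.Theory.
Export numFieldNormedType.Exports.

Set Implicit Arguments.
Unset Strict Implicit.
Unset Printing Implicit Defensive.

Local Open Scope classical_set_scope.
Local Open Scope ring_scope.

Section independence.
Context {d : measure_display} {T : measurableType d} {R : realType}.
Variable P : probability T R.

(* Mutual independence of a family of classes of events: the product rule holds
   along every finite subfamily, listed without repetition by [J]. *)
Definition mutually_independent (I : eqType) (F : I -> set (set T)) : Prop :=
  forall (J : seq I) (E : I -> set T),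
    uniq J -> (forall i, i \in J -> F i (E i)) ->
    P (\bigcap_(i in [set` J]) E i) = (\prod_(i <- J) P (E i))%E.

Definition sigma_seq (X : nat -> {RV P >-> R}) : set (set T) :=
  <<s \bigcup_n g_sigma_algebra_preimage (X n) >>.

Definition iid (X : nat -> {RV P >-> R}) : Prop :=
  mutually_independent (fun n => g_sigma_algebra_preimage (X n)) /\
  forall n (E : set R), measurable E ->
    distribution P (X n) E = distribution P (X 0%N) E.

Definition independent_sequences (X Y Z : nat -> {RV P >-> R}) : Prop :=
  mutually_independent
    (fun k : 'I_3 => sigma_seq (tnth [tuple X; Y; Z] k)).

(* [E (exp (- s X))]; the expectation is finite whenever [0 <= s] and [X >= 0]
   almost surely, the only case in which [fine] is meaningful here. *)
Definition LST (X : {RV P >-> R}) (s : R) : R := fine ('M_P X (- s)).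

End independence.

(* The limit [Y] may live on another probability space; being real-valued, it
   is a proper (almost surely finite) limit. *)
Definition cvg_weakly {R : realType}
    {d : measure_display} {T : measurableType d} {P : probability T R}
    {d' : measure_display} {T' : measurableType d'} {Q : probability T' R}
    (X : nat -> {RV P >-> R}) (Y : {RV Q >-> R}) : Prop :=
  forall f : R -> R, continuous f -> (exists M, forall x, `|f x| <= M) ->
    ('E_P[f \o X n])%E @[n --> \oo] --> ('E_Q[f \o Y])%E.

(* [Rintegral] is only meaningful on integrable functions; the integrands used
   below, including those singular at an endpoint, are absolutely integrable. *)
Definition oint {R : realType} (a b : R) (f : R -> R) : R :=
  if a <= b then \int[lebesgue_measure]_(x in `[a, b]) f x
  else - \int[lebesgue_measure]_(x in `[b, a]) f x.

Definition p_infty {R : realType} (lambda : R) (PhiB : R -> R) : R :=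
  (oint 0 lambda (fun u => (lambda - u)^-1 *
     expR (- oint 0 u (fun t =>
       lambda * PhiB t / (t * (lambda - t)) - t^-1))))^-1.

(* Main.v *)
Require Import Defs.
From mathcomp Require Import measurable_realfun ring lra.

(** W_n has the law of the backward iterate M_n = f_0 o ... o f_(n-1) (w), where
    f_k x = [V_k x + B_k - A_k]^+ .  Almost surely
    |M_(n+1) - M_n| <= V_0 ... V_(n-1) (w + B_n), whose mean is 2^-n (w + E B_0), so
    M_n converges almost surely and W_n converges weakly to the law of its limit.
    Integrating out A_n, B_n and V_n in one step of the recursion and letting n go to
    infinity gives, with F s = int_0^s Phi_W,
      (s - lambda) F' s = s p - lambda Phi_B s / s F s.
    Multiplying by the integrating factor makes F an exact primitive.  Since F is
    bounded near lambda and the integrating factor vanishes there (this uses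
    Phi_B lambda > 0), no boundary term survives at lambda, which determines F on
    both sides of lambda; the condition F s / s --> 1 at 0 identifies p with p_infty. *)

Set Implicit Arguments.
Unset Strict Implicit.
Unset Printing Implicit Defensive.

Local Open Scope classical_set_scope.
Local Open Scope ring_scope.

(** * Improper integrals *)

(** In the forward recursion each new random map acts outermost, so the path keeps fluctuating. In
    the opposite order the new map acts innermost, where all earlier factors [V] damp it; equality
    in law then holds for each fixed n only, which suffices for weak convergence. It requires every
    intermediate state to be independent of all inputs not yet used, so the three sequences are
    merged into one family and independence is tracked against the set of used indices. The constant
    p is the limit of E exp(- lambda (V_n W_n + B_n)), the probability that the next state is 0. The
    finite mean of B_0 serves twice: it makes the increments summable, and it makes the inner
    integrand of [p_infty] bounded near 0. The outer integrands are singular at lambda, whence a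
    fundamental theorem of calculus for non-negative functions on open intervals. *)

Lemma ge0_FTC2_itvoo (R : realType) (f F : R -> R) (a b la lb : R) :
  a < b ->
  {in `]a, b[, continuous f} ->
  {in `]a, b[, forall x, 0 <= f x} ->
  {in `]a, b[, forall x : R, is_derive x 1 F (f x)} ->
  F x @[x --> a^'+] --> la -> F x @[x --> b^'-] --> lb ->
  (\int[lebesgue_measure]_(x in `[a, b]) (f x)%:E = (lb - la)%:E)%E.
Proof.
move=> ab cf f0 dF Fa Fb.
have mf : measurable_fun `]a, b[ f.
  apply: open_continuous_measurable_fun; first exact: interval_open.
  by move=> x /set_mem; exact: cf.
rewrite integral_itv_bndoo; last exact/measurable_EFinP.
(* [n.+3] makes already [e 0] smaller than half the length, so every [D n] is a nondegenerate
   interval. *)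
pose e (n : nat) : R := (b - a) / n.+3%:R.
have e_gt0 n : 0 < e n by rewrite divr_gt0 ?subr_gt0.
have e_lt n : e n < (b - a) / 2.
  by rewrite /e ltr_pM2l ?subr_gt0// ltf_pV2 ?posrE// ltr_nat.
have e_cvg : e n @[n --> \oo] --> (0 : R).
  rewrite -(mulr0 (b - a)); apply: cvgMr.
  by have := @cvg_harmonic R; rewrite -(cvg_shiftn 2) /=; under eq_fun do rewrite addn2.
have aecvg : a + e n @[n --> \oo] --> a.
  by rewrite -[X in _ --> X]addr0; apply: cvgD => //; exact: cvg_cst.
have becvg : b - e n @[n --> \oo] --> b.
  by rewrite -[X in _ --> X]subr0; apply: cvgB => //; exact: cvg_cst.
pose D (n : nat) := `[a + e n, b - e n]%classic.
have Dsub n : D n `<=` `]a, b[.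
  move=> x; rewrite /D/= !in_itv/= => /andP[h1 h2].
  by have ? := e_gt0 n; apply/andP; split; lra.
have nndD : nondecreasing_seq D.
  move=> m n mn; apply/subsetPset => x; rewrite /D/= !in_itv/= => /andP[h1 h2].
  have : e n <= e m.
    by rewrite /e ler_pM2l ?subr_gt0// lef_pV2 ?posrE// ler_nat !ltnS.
  by move=> ?; apply/andP; split; lra.
have UD : `]a, b[%classic = \bigcup_n D n.
  apply/seteqP; split=> [x|x [n _]]; last exact: Dsub.
  rewrite /= in_itv/= => /andP[ax xb].
  have /cvgrPdist_lt/(_ (Num.min (x - a) (b - x))) := e_cvg.
  rewrite lt_min !subr_gt0 ax xb => /(_ isT)[n _ /(_ n (leqnn _))].
  rewrite sub0r normrN gtr0_norm// lt_min => /andP[h1 h2].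
  by exists n => //; rewrite /D/= in_itv/=; apply/andP; split; lra.
have intD n : (\int[lebesgue_measure]_(x in D n) (f x)%:E =
    (F (b - e n))%:E - (F (a + e n))%:E)%E.
  have abn : a + e n < b - e n by have := e_lt n; lra.
  have sub x : x \in `]a + e n, b - e n[ -> x \in `]a, b[.
    rewrite !in_itv/= => /andP[h1 h2]; have := e_gt0 n => ?.
    by apply/andP; split; lra.
  have subc x : x \in `[a + e n, b - e n] -> x \in `]a, b[.
    rewrite !in_itv/= => /andP[h1 h2]; have := e_gt0 n => ?.
    by apply/andP; split; lra.
  have cF x : x \in `[a + e n, b - e n] -> {for x, continuous F}.
    move=> /subc/dF dFx; apply: differentiable_continuous.
    exact/derivable1_diffP.
  apply: continuous_FTC2 => //.
  - by apply: continuous_in_subspaceT => x /set_mem /= /subc; exact: cf.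
  - split.
    + by move=> x /sub/dF.
    + by apply/cvg_at_right_filter/cF; rewrite in_itv/= lexx ltW.
    + by apply/cvg_at_left_filter/cF; rewrite in_itv/= lexx ltW.
  - by move=> x /sub/dF dFx; rewrite derive1E derive_val.
(* Monotone convergence along the exhaustion [D n]: as [f] is non-negative, integrability up to the
   singular endpoints never has to be checked beforehand. *)
have h1 : (\int[lebesgue_measure]_(x in D n) (f x)%:E @[n --> \oo] -->
    \int[lebesgue_measure]_(x in `]a, b[) (f x)%:E)%E.
  rewrite UD; apply: ge0_nondecreasing_set_cvg_integral => //.
  - by move=> n; exact: measurable_itv.
  - by move=> n; apply/measurable_EFinP; exact: measurable_funS mf.
  - by move=> n x /Dsub /= xab; rewrite lee_fin; exact: f0.
have h2 : (\int[lebesgue_measure]_(x in D n) (f x)%:E @[n --> \oo] -->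
    (lb - la)%:E)%E.
  under eq_fun do rewrite intD.
  apply: cvg_EFin; first exact: nearW.
  apply: cvgB.
  - move/cvg_at_leftP : Fb => /(_ (fun n => b - e n)); apply; split => // n.
    by rewrite gtrBl.
  - move/cvg_at_rightP : Fa => /(_ (fun n => a + e n)); apply; split => // n.
    by rewrite ltrDl.
exact: cvg_unique h1 h2.
Qed.

(** A derivative with at least a simple pole of residue [c] at [b] makes [K x + c * ln (b - x)]
    nondecreasing, so [expR (- K x)] is at most a constant times the power [c] of [b - x]. This
    removes the boundary terms at lambda. *)
Lemma expRN_cvg0_left (R : realType) (K k : R -> R) (a b c : R) :
  a < b -> 0 < c ->
  {in `]a, b[, forall x : R, is_derive x 1 K (k x)} ->
  {in `]a, b[, forall x, c / (b - x) <= k x} ->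
  expR (- K x) @[x --> b^'-] --> (0 : R).
Proof.
move=> ab c0 dK kc.
pose D x := K x + c * ln (b - x).
have dD : {in `]a, b[, forall x : R, is_derive x 1 D (k x - c / (b - x))}.
  move=> x; rewrite in_itv/= => /andP[ax xb].
  have bx : 0 < b - x by rewrite subr_gt0.
  have dKx : is_derive x 1 K (k x) by apply: dK; rewrite in_itv/= ax xb.
  have dln : is_derive (b - x) 1 (@ln R) (b - x)^-1 by exact: is_derive1_ln.
  have db : is_derive x 1 (fun y : R => b - y) (-1).
    by rewrite -[X in is_derive _ _ _ X]sub0r; exact: is_deriveB.
  have dl : is_derive x 1 (fun y => ln (b - y)) ((b - x)^-1 * -1).
    exact: (@is_derive1_comp R (@ln R) (fun y => b - y)).
  rewrite /D; apply: is_derive_eq.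
  by rewrite /GRing.scale/=; ring.
pose m := (a + b) / 2.
have am : a < m by rewrite /m; lra.
have mb : m < b by rewrite /m; lra.
have D_ge x : m <= x -> x < b -> D m <= D x.
  move=> mx xb.
  have sub y : y \in `[m, x] -> y \in `]a, b[.
    by rewrite !in_itv/= => /andP[h1 h2]; apply/andP; split; lra.
  apply: (@ger0_derive1_ndecr R D m x) => //.
  - by move=> y ymx; have := dD y (sub y (subset_itv_oo_cc ymx)).
  - move=> y ymx; have yab := sub y (subset_itv_oo_cc ymx).
    have := dD y yab => ?; rewrite derive1E derive_val subr_ge0.
    exact: kc.
  - apply: derivable_within_continuous => y ymx.
    by have := dD y (sub y ymx).
have le_x x : m <= x -> x < b -> expR (- K x) <= expR (- D m) * expR (c * ln (b - x)).
  move=> mx xb; rewrite -expRD ler_expR; have := D_ge x mx xb.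
  by rewrite /D; lra.
apply: (@squeeze_cvgr _ _ _ _ (cst 0) (fun x => expR (- D m) * expR (c * ln (b - x)))).
- near=> x; rewrite expR_ge0/=; apply: le_x.
  + by near: x; exact: nbhs_left_ge.
  + by near: x; exact: nbhs_left_lt.
- exact: cvg_cst.
- rewrite -[X in _ --> X](mulr0 (expR (- D m))); apply: cvgMr.
  apply/cvgrPdist_lt => e e0.
  near=> x.
  have xb : x < b by near: x; exact: nbhs_left_lt.
  (* Solved for [x], the inequality reads [b - expR (ln e / c) < x], which holds close to [b]. *)
  rewrite sub0r normrN gtr0_norm ?expR_gt0// -(lnK (x := e))// ltr_expR.
  rewrite mulrC -ltr_pdivlMr// -(expRK (ln e / c)) ltr_ln ?posrE ?expR_gt0 ?subr_gt0//.
  rewrite ltrBlDl -ltrBlDr; near: x; apply: nbhs_left_gt.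
  by rewrite gtrBl expR_gt0.
Unshelve. all: by end_near. Qed.

(** Mirror image of [expRN_cvg0_left], applied to [- K (- u)]; this accounts for the missing minus
    sign in the exponential. *)
Lemma expR_cvg0_right (R : realType) (K k : R -> R) (b a c : R) :
  b < a -> 0 < c ->
  {in `]b, a[, forall x : R, is_derive x 1 K (k x)} ->
  {in `]b, a[, forall x, c / (x - b) <= k x} ->
  expR (K x) @[x --> b^'+] --> (0 : R).
Proof.
move=> ba c0 dK kc.
have mem (u : R) : u \in `]- a, - b[ -> - u \in `]b, a[.
  by rewrite !in_itv/= ltrNl ltrNr andbC.
apply/cvg_at_rightNP.
have -> : (fun x => expR (K x)) \o -%R = (fun x => expR (- - K (- x))).
  by apply/funext => x /=; rewrite opprK.
apply: (@expRN_cvg0_left R (fun u => - K (- u)) (fun u => k (- u)) (- a) (- b) c) => //.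
- by rewrite ltrN2.
- move=> u /mem /dK dKu.
  have du : is_derive u 1 (fun y : R => - y) (- 1) by exact: is_deriveN.
  have dKN : is_derive u 1 (fun y : R => K (- y)) (k (- u) * -1).
    exact: (@is_derive1_comp R K (fun y : R => - y)).
  have -> : k (- u) = - (k (- u) * -1) by rewrite mulrN1 opprK.
  exact: is_deriveN.
- by move=> u /mem /kc; rewrite (addrC (- b)).
Qed.

(** * Integrals as functions of an endpoint *)

Section integral_endpoints.
Context {R : realType}.
Local Notation mu := (@lebesgue_measure R).
Implicit Types (h : R -> R) (a b x : R).

Lemma continuous_itvcc_integrable h a b :
  {in `[a, b], continuous h} -> mu.-integrable `[a, b] (EFin \o h).
Proof.
move=> ch; apply: continuous_compact_integrable; first exact: segment_compact.
by apply: continuous_in_subspaceT => x /set_mem/= xab; exact: ch.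
Qed.

Lemma is_derive_integral_right h a b x :
  mu.-integrable `[a, b] (EFin \o h) -> {for x, continuous h} ->
  a < x < b -> is_derive x 1 (fun y => \int[mu]_(t in `[a, y]) h t) (h x).
Proof.
move=> ih cx /andP[ax xb].
have [dF F'] := continuous_FTC1_closed xb ih ax cx.
by rewrite -F' derive1E; exact: derivableP.
Qed.

Lemma Rintegral_itv_split h a b x :
  mu.-integrable `[a, b] (EFin \o h) -> a <= x <= b ->
  \int[mu]_(t in `[x, b]) h t =
  \int[mu]_(t in `[a, b]) h t - \int[mu]_(t in `[a, x]) h t.
Proof.
move=> ih /andP[ax xb].
rewrite Rintegral_itvB ?bnd_simp// Rintegral_itv_obnd_cbnd//.
by apply: integrableS ih => //; apply: subset_itvr; rewrite bnd_simp.
Qed.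

Lemma is_derive_integral_left h a b x :
  mu.-integrable `[a, b] (EFin \o h) -> {for x, continuous h} ->
  a < x < b -> is_derive x 1 (fun y => \int[mu]_(t in `[y, b]) h t) (- h x).
Proof.
move=> ih cx axb; have /andP[ax xb] := axb.
have dF := is_derive_integral_right ih cx axb.
apply: (@near_eq_is_derive _ _ _
  (fun y => \int[mu]_(t in `[a, b]) h t - \int[mu]_(t in `[a, y]) h t)).
- near=> y; rewrite -Rintegral_itv_split//; apply/andP; split.
    by apply/ltW; near: y; exact: lt_nbhsr.
  by apply/ltW; near: y; exact: lt_nbhsl.
- by rewrite -[X in is_derive _ _ _ X]sub0r; exact: is_deriveB.
Unshelve. all: by end_near. Qed.

Lemma integral_right_cvg0 h a b : a < b ->
  mu.-integrable `[a, b] (EFin \o h) ->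
  \int[mu]_(t in `[a, y]) h t @[y --> a^'+] --> (0 : R).
Proof.
by move=> ab ih; apply: cvg_at_right_filter; exact: (parameterized_integral_cvg_left ab).
Qed.

Lemma integral_left_cvg0 h a b : a < b ->
  mu.-integrable `[a, b] (EFin \o h) ->
  \int[mu]_(t in `[y, b]) h t @[y --> b^'-] --> (0 : R).
Proof.
move=> ab ih; set I := \int[mu]_(t in `[a, b]) h t.
have : I - \int[mu]_(t in `[a, y]) h t @[y --> b^'-] --> I - I.
  by apply: cvgB; [exact: cvg_cst|exact: parameterized_integral_cvg_at_left].
rewrite subrr; apply: cvg_trans; apply: near_eq_cvg; near=> y.
rewrite -Rintegral_itv_split//; apply/andP; split.
  by near: y; exact: nbhs_left_ge.
by near: y; exact: nbhs_left_le.
Unshelve. all: by end_near. Qed.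

End integral_endpoints.

(** * A singular linear differential equation *)

Lemma expR_cvg (R : realType) (T : Type) (Fl : set_system T) (FF : Filter Fl)
    (f : T -> R) (l : R) :
  f x @[x --> Fl] --> l -> expR (f x) @[x --> Fl] --> expR l.
Proof. by move=> fl; apply: cvg_comp fl _; exact: continuous_expR. Qed.

Lemma is_derive_cont (R : realType) (f : R -> R) (x df : R) :
  is_derive x 1 f df -> {for x, continuous f}.
Proof.
move=> dfx; apply: differentiable_continuous.
exact/derivable1_diffP.
Qed.

Section linear_ode.
Context {R : realType}.
Local Notation mu := (@lebesgue_measure R).
Variables (lambda p m : R) (Phi PhiB F : R -> R).
Hypothesis lambda_gt0 : 0 < lambda.
Hypothesis PhiB_cont : forall t : R, 0 < t -> {for t, continuous PhiB}.
Hypothesis PhiB_gt0 : forall t : R, 0 < t -> 0 < PhiB t.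
Hypothesis PhiB_le1 : forall t : R, 0 < t -> PhiB t <= 1.
Hypothesis PhiB_nincr : forall s t : R, 0 < s -> s <= t -> PhiB t <= PhiB s.
Hypothesis PhiB_mean : forall t : R, 0 < t -> 1 - PhiB t <= m * t.
Hypothesis dF : forall s : R, 0 < s -> is_derive s 1 F (Phi s).
Hypothesis F_bound : forall s : R, 0 < s -> 0 < F s <= s.
Hypothesis F_slope0 : F s / s @[s --> 0^'+] --> (1 : R).
Hypothesis Phi_eq : forall s : R, 0 < s ->
  (s - lambda) * Phi s = s * p - lambda * PhiB s / s * F s.

(** At the singular point the left side of [Phi_eq] vanishes, so [p] is a positive multiple of
    [F lambda]. *)
Lemma ode_p_gt0 : 0 < p.
Proof.
have := Phi_eq lambda_gt0; rewrite subrr mul0r => /esym/eqP.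
rewrite subr_eq0 => /eqP e.
have : 0 < lambda * p.
  have /andP[F0 _] := F_bound lambda_gt0.
  by rewrite e !mulr_gt0// ?invr_gt0// PhiB_gt0.
by rewrite pmulr_rgt0.
Qed.

Let p_gt0 := ode_p_gt0.
Let p_neq0 : p != 0. Proof. by rewrite gt_eqF. Qed.

(** Divided by [s - lambda], the equation reads [F' = lambda * h * F + p * s / (s - lambda)]; the
    integrating factor is the exponential of [- lambda] times a primitive of [h]. *)
Definition ode_rate (t : R) := PhiB t / (t * (lambda - t)).
Local Notation h := ode_rate.

Lemma ode_rate_cont (t : R) : 0 < t -> t != lambda -> {for t, continuous h}.
Proof.
move=> t0 tl; apply: continuousM; first exact: PhiB_cont.
apply: continuousV.
  by rewrite mulf_neq0 ?(gt_eqF t0)// subr_eq0 eq_sym.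
apply: continuousM; first exact: cvg_id.
by apply: continuousB; [exact: cvg_cst|exact: cvg_id].
Qed.

Let F_cont (s : R) : 0 < s -> {for s, continuous F}.
Proof. by move=> /dF; exact: is_derive_cont. Qed.

Let Phi_solve (u : R) : 0 < u -> u != lambda ->
  Phi u = (u * p - lambda * PhiB u / u * F u) / (u - lambda).
Proof.
move=> u0 ul; rewrite -Phi_eq// mulrAC divff ?mul1r//.
by rewrite subr_eq0.
Qed.

Let bounded_mul_cvg0 (T : Type) (Fl : set_system T) {FF : Filter Fl}
    (f g : T -> R) (M : R) : (\forall x \near Fl, `|f x| <= M) ->
  g x @[x --> Fl] --> (0 : R) -> f x * g x @[x --> Fl] --> (0 : R).
Proof.
move=> fM g0; apply/norm_cvg0P.
apply: (@squeeze_cvgr _ _ _ _ (cst 0) (fun x => M * `|g x|)).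
- near=> x; rewrite /= normr_ge0/= normrM ler_wpM2r//.
  by near: x.
- exact: cvg_cst.
- by rewrite -[X in _ --> X](mulr0 M); apply: cvgMr; exact/norm_cvg0P.
Unshelve. all: by end_near. Qed.

(** By [Phi_solve], [- F u / p * expR (- K u)] is a primitive of [u / (lambda - u) * expR (- K u)];
    the sign makes the integrand non-negative, as [ge0_FTC2_itvoo] requires. It tends to [- F s / p]
    at [s], where [K] vanishes, and to 0 at lambda. *)
Lemma ode_solution_lt (s : R) : 0 < s -> s < lambda ->
  F s = p * oint lambda s (fun u => u / (u - lambda) *
    expR (lambda * oint u s (fun t => PhiB t / (t * (lambda - t))))).
Proof.
move=> s0 sl.
pose K (u : R) := lambda * \int[mu]_(t in `[s, u]) h t.
pose f (u : R) : R := u / (lambda - u) * expR (- K u).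
have ih (v : R) : s <= v -> v < lambda -> mu.-integrable `[s, v] (EFin \o h).
  move=> sv vl; apply: continuous_itvcc_integrable => x; rewrite in_itv/= => /andP[sx xv].
  by apply: ode_rate_cont; [exact: lt_le_trans sx|rewrite lt_eqF// (le_lt_trans xv)].
have dK : {in `]s, lambda[, forall u : R, is_derive u 1 K (lambda * h u)}.
  move=> u; rewrite in_itv/= => /andP[su ul].
  have d1 : is_derive u 1 (fun y => \int[mu]_(t in `[s, y]) h t) (h u).
    apply: (@is_derive_integral_right _ _ _ ((u + lambda) / 2)).
    - by apply: ih; lra.
    - by apply: ode_rate_cont; [exact: lt_trans su|rewrite lt_eqF].
    - by apply/andP; split; lra.
  exact: is_deriveZ.
have de (u : R) : u \in `]s, lambda[ ->
    is_derive u 1 (fun y => expR (- K y)) (expR (- K u) * - (lambda * h u)).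
  move=> /dK dKu; exact: (@is_derive1_comp R (@expR R) (fun y => - K y)).
have fE : (\int[mu]_(u in `[s, lambda]) (f u)%:E = (0 - (- F s / p))%:E)%E.
  apply: (@ge0_FTC2_itvoo _ _ (fun u => - F u / p * expR (- K u))) => //.
  - move=> u uI; have /andP[su ul] : s < u < lambda by rewrite in_itv in uI.
    apply: cvgM.
      apply: cvgM; first exact: cvg_id.
      apply: cvgV; first by rewrite subr_eq0 gt_eqF.
      by apply: cvgB; [exact: cvg_cst|exact: cvg_id].
    exact: (is_derive_cont (de _ uI)).
  - move=> u; rewrite in_itv/= => /andP[su ul].
    by rewrite mulr_ge0 ?expR_ge0// divr_ge0//; lra.
  - move=> u uI; have /andP[su ul] : s < u < lambda by rewrite in_itv in uI.
    have deu := de _ uI.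
    have u0 : 0 < u by lra.
    have dFu := dF u0.
    apply: is_derive_eq.
    rewrite /GRing.scale/= /f /h Phi_solve ?lt_eqF//; field.
    by rewrite p_neq0 !subr_eq0 (gt_eqF ul) (lt_eqF ul) (gt_eqF u0).
  - rewrite -[X in _ --> X]mulr1; apply: cvgM.
      apply: cvg_at_right_filter; apply: cvgMl; apply: cvgN; exact: F_cont.
    have -> : 1 = expR (- (lambda * 0)) :> R by rewrite mulr0 oppr0 expR0.
    apply: expR_cvg; apply: cvgN; apply: cvgMr.
    by apply: (@integral_right_cvg0 _ _ _ ((s + lambda) / 2)); [lra|apply: ih; lra].
  - apply: (@bounded_mul_cvg0 _ _ _ _ _ (lambda / p)).
      near=> u.
      have u0 : 0 < u by near: u; exact: nbhs_left_gt.
      have ul : u <= lambda by near: u; exact: nbhs_left_le.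
      have /andP[Fu0 Fu] := F_bound u0.
      rewrite normrM normrN !gtr0_norm ?invr_gt0// ler_pM2r ?invr_gt0//.
      exact: le_trans ul.
    (* The residue is at least [PhiB lambda], since [lambda / u >= 1] and [PhiB u >= PhiB lambda] to
       the left of lambda. *)
    apply: (@expRN_cvg0_left R K (fun u => lambda * h u) s lambda (PhiB lambda)) => //.
      exact: PhiB_gt0.
    move=> u; rewrite in_itv/= => /andP[su ul]; rewrite /h.
    have u0 : 0 < u by lra.
    rewrite invfM mulrA mulrA ler_pM2r ?invr_gt0 ?subr_gt0//.
    rewrite ler_pdivlMr// mulrC.
    apply: ler_pM => //; [exact: ltW|exact/ltW/PhiB_gt0|exact: ltW|].
    exact: PhiB_nincr (ltW ul).
(* For [s < lambda], [oint] reverses the sign of the outer and of the inner integral; the sign of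
   [u - lambda] compensates the outer one. *)
rewrite /oint leNgt sl/= /Rintegral.
rewrite (_ : (\int[mu]_(x in `[s, lambda]) _)%E =
             (\int[mu]_(x in `[s, lambda]) (- (f x)%:E))%E); last first.
  apply: eq_integral => u /set_mem/=; rewrite in_itv/= => /andP[su ul].
  rewrite /f -mulNr -mulrN -invrN opprB; congr (_ * expR _)%:E.
  (* At [u = s] the inner [oint] falls into its other branch; both integrals are then over a single
     point. *)
  case: ltgtP su => // [us|us] _; first by rewrite mulrN.
  by rewrite /K /Rintegral us set_itv1 !integral_set1 /= !mulr0 oppr0.
rewrite integral_ge0N; last first.
  move=> u /=; rewrite in_itv/= => /andP[su ul].
  by rewrite lee_fin mulr_ge0 ?expR_ge0// divr_ge0//; lra.
by rewrite fE/= sub0r mulNr !opprK mulrCA divff// mulr1.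
Unshelve. all: by end_near. Qed.

(** Right of lambda the rate [h] is negative, and [K], now integrated from [u] up to [s], tends to
    minus infinity at lambda. The primitive [F u / p * expR (K u)] goes from 0 at lambda to
    [F s / p] at [s]. *)
Lemma ode_solution_gt (s : R) : lambda < s ->
  F s = p * oint lambda s (fun u => u / (u - lambda) *
    expR (lambda * oint u s (fun t => PhiB t / (t * (lambda - t))))).
Proof.
move=> ls.
have s0 : 0 < s by exact: lt_trans ls.
pose K (u : R) := lambda * \int[mu]_(t in `[u, s]) h t.
pose f (u : R) : R := u / (u - lambda) * expR (K u).
have ih (v : R) : lambda < v -> mu.-integrable `[v, s] (EFin \o h).
  move=> lv; apply: continuous_itvcc_integrable => x; rewrite in_itv/= => /andP[vx xs].
  have lx := lt_le_trans lv vx.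
  by apply: ode_rate_cont; [exact: lt_trans lx|rewrite gt_eqF].
have dK : {in `]lambda, s[, forall u : R, is_derive u 1 K (- (lambda * h u))}.
  move=> u; rewrite in_itv/= => /andP[lu us]; rewrite -mulrN.
  have d1 : is_derive u 1 (fun y => \int[mu]_(t in `[y, s]) h t) (- h u).
    apply: (@is_derive_integral_left _ _ ((u + lambda) / 2)).
    - by apply: ih; lra.
    - by apply: ode_rate_cont; [exact: lt_trans lu|rewrite gt_eqF].
    - by apply/andP; split; lra.
  exact: is_deriveZ.
have de (u : R) : u \in `]lambda, s[ ->
    is_derive u 1 (fun y => expR (K y)) (expR (K u) * - (lambda * h u)).
  move=> /dK dKu; exact: (@is_derive1_comp R (@expR R) K).
have fE : (\int[mu]_(u in `[lambda, s]) (f u)%:E = (F s / p - 0)%:E)%E.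
  apply: (@ge0_FTC2_itvoo _ _ (fun u => F u / p * expR (K u))) => //.
  - move=> u uI; have /andP[lu us] : lambda < u < s by rewrite in_itv in uI.
    apply: cvgM.
      apply: cvgM; first exact: cvg_id.
      apply: cvgV; first by rewrite subr_eq0 gt_eqF.
      by apply: cvgB; [exact: cvg_id|exact: cvg_cst].
    exact: (is_derive_cont (de _ uI)).
  - move=> u; rewrite in_itv/= => /andP[lu us]; have u0 := lt_trans lambda_gt0 lu.
    by rewrite mulr_ge0 ?expR_ge0// divr_ge0 ?subr_ge0// ltW.
  - move=> u uI; have /andP[lu us] : lambda < u < s by rewrite in_itv in uI.
    have deu := de _ uI.
    have u0 := lt_trans lambda_gt0 lu.
    have dFu := dF u0.
    apply: is_derive_eq.
    rewrite /GRing.scale/= /f /h Phi_solve ?gt_eqF//; field.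
    by rewrite p_neq0 !subr_eq0 (gt_eqF lu) (lt_eqF lu) (gt_eqF u0).
  - apply: (@bounded_mul_cvg0 _ _ _ _ _ (s / p)).
      near=> u.
      have lu : lambda < u by near: u; exact: nbhs_right_gt.
      have u0 : 0 < u by exact: lt_trans lu.
      have us : u <= s by near: u; exact: nbhs_right_le.
      have /andP[Fu0 Fu] := F_bound u0.
      rewrite normrM !gtr0_norm ?invr_gt0// ler_pM2r ?invr_gt0//.
      exact: le_trans us.
    (* On []lambda, s[] both [PhiB v] and [v^-1] are bounded below by their values at the far
       endpoint [s], whence this residue. *)
    apply: (@expR_cvg0_right R K (fun u => - (lambda * h u)) lambda s
      (lambda * PhiB s / s)) => //.
    + by rewrite divr_gt0// mulr_gt0// PhiB_gt0.
    + move=> v; rewrite in_itv/= => /andP[lv vs].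
      have v0 := lt_trans lambda_gt0 lv.
      have -> : - (lambda * h v) = lambda * PhiB v / v / (v - lambda).
        rewrite /h; field.
        by rewrite !subr_eq0 (gt_eqF lv) (lt_eqF lv) (gt_eqF v0).
      rewrite ler_pM2r ?invr_gt0 ?subr_gt0//.
      apply: ler_pM.
      * by apply/ltW; rewrite mulr_gt0// PhiB_gt0.
      * by rewrite invr_ge0 ltW.
      * by rewrite ler_pM2l//; apply: PhiB_nincr => //; exact: ltW.
      * by rewrite lef_pV2 ?posrE// ltW.
  - rewrite -[X in _ --> X]mulr1; apply: cvgM.
      by apply: cvg_at_left_filter; apply: cvgMl; exact: F_cont.
    have -> : 1 = expR (lambda * 0) :> R by rewrite mulr0 expR0.
    apply: expR_cvg; apply: cvgMr.
    by apply: (@integral_left_cvg0 _ _ ((s + lambda) / 2)); [lra|apply: ih; lra].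
rewrite /oint (ltW ls) /Rintegral.
rewrite (_ : (\int[mu]_(x in `[lambda, s]) _)%E =
             (\int[mu]_(x in `[lambda, s]) (f x)%:E)%E); last first.
  apply: eq_integral => u /set_mem/=; rewrite in_itv/= => /andP[lu us].
  by rewrite us.
by rewrite fE/= subr0 mulrCA divff// mulr1.
Unshelve. all: by end_near. Qed.

(** The equation is homogeneous in the pair of [F] and [p]; the slope of [F] at 0 fixes the scale.
    The integrating factor is therefore adapted to [F u / u]: the term [t^-1] in [g] comes from
    differentiating this quotient and cancels the pole of [lambda * h] at 0, so that [K] can start
    at 0. The primitive goes from [- 1 / p] at 0 to 0 at lambda. *)
Lemma ode_p_inftyE : p = p_infty lambda PhiB.
Proof.
pose g (t : R) := lambda * PhiB t / (t * (lambda - t)) - t^-1.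
pose K (u : R) := \int[mu]_(t in `[0, u]) g t.
pose f (u : R) : R := (lambda - u)^-1 * expR (- K u).
(* This form shows the cancellation at 0: by [PhiB_mean], [(1 - PhiB t) / t] stays between 0 and
   [m]. *)
have gE (t : R) : 0 < t -> t < lambda ->
    g t = (1 - lambda * ((1 - PhiB t) / t)) / (lambda - t).
  move=> t0 tl; rewrite /g; field.
  by rewrite subr_eq0 (gt_eqF tl) (gt_eqF t0).
have g_cont (t : R) : 0 < t -> t < lambda -> {for t, continuous g}.
  move=> t0 tl; apply: cvgB.
    have -> : (fun t => lambda * PhiB t / (t * (lambda - t))) = (fun t => lambda * h t).
      by apply/funext => x; rewrite mulrA.
    by rewrite -mulrA; apply: cvgMr; apply: ode_rate_cont; rewrite ?lt_eqF.
  by apply: cvgV; [rewrite gt_eqF|exact: cvg_id].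
have ig (v : R) : 0 <= v -> v < lambda -> mu.-integrable `[0, v] (EFin \o g).
  move=> v0 vl; apply: measurable_bounded_integrable.
  - exact: measurable_itv.
  - by apply: compact_finite_measure; exact: segment_compact.
  - apply/measurable_fun_itv_obnd_cbndP.
    apply: subspace_continuous_measurable_fun; first exact: measurable_itv.
    apply: continuous_in_subspaceT => x /set_mem/=; rewrite in_itv/= => /andP[x0 xv].
    by apply: g_cont => //; exact: le_lt_trans vl.
  - exists ((1 + lambda * m) / (lambda - v)); split; first exact: num_real.
    move=> y /ltW ym x /=; rewrite in_itv/= => /andP[x0 xv].
    apply: le_trans ym; move: x0 xv; rewrite le_eqVlt => /predU1P[<- _|x0 xv].
      (* At 0 the convention [0^-1 = 0] gives [g 0 = 0]. *)
      rewrite /g mul0r invr0 mulr0 subr0 normr0 divr_ge0//; last lra.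
      have : 0 <= m.
        have := PhiB_mean lambda_gt0; have := PhiB_le1 lambda_gt0 => ? ?.
        by rewrite -(pmulr_lge0 _ lambda_gt0); lra.
      by move=> m0; rewrite addr_ge0// mulr_ge0// ltW.
    have xl : x < lambda by exact: le_lt_trans vl.
    have q0 : 0 <= (1 - PhiB x) / x by rewrite divr_ge0 ?subr_ge0 ?PhiB_le1// ltW.
    have qm : (1 - PhiB x) / x <= m by rewrite ler_pdivrMr// PhiB_mean.
    have h1 : 0 <= lambda * ((1 - PhiB x) / x) by rewrite mulr_ge0// ltW.
    have h2 : lambda * ((1 - PhiB x) / x) <= lambda * m by rewrite ler_pM2l.
    rewrite gE// normrM; apply: ler_pM => //.
      by rewrite ler_norml; apply/andP; split; lra.
    by rewrite gtr0_norm ?invr_gt0 ?subr_gt0// lef_pV2 ?posrE ?subr_gt0//; lra.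
have dK : {in `]0, lambda[, forall u : R, is_derive u 1 K (g u)}.
  move=> u; rewrite in_itv/= => /andP[u0 ul].
  apply: (@is_derive_integral_right _ _ _ ((u + lambda) / 2)).
  - by apply: ig; lra.
  - exact: g_cont.
  - by apply/andP; split; lra.
have de (u : R) : u \in `]0, lambda[ ->
    is_derive u 1 (fun y => expR (- K y)) (expR (- K u) * - g u).
  move=> /dK dKu; exact: (@is_derive1_comp R (@expR R) (fun y => - K y)).
have fE : (\int[mu]_(u in `[0%R, lambda]) (f u)%:E = (0 - (- 1 / p))%:E)%E.
  apply: (@ge0_FTC2_itvoo _ _ (fun u => - (F u / u) / p * expR (- K u))) => //.
  - move=> u uI; have /andP[u0 ul] : 0 < u < lambda by rewrite in_itv in uI.
    apply: cvgM; last exact: (is_derive_cont (de _ uI)).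
    apply: cvgV; first by rewrite subr_eq0 gt_eqF.
    by apply: cvgB; [exact: cvg_cst|exact: cvg_id].
  - move=> u; rewrite in_itv/= => /andP[u0 ul].
    by rewrite mulr_ge0 ?expR_ge0// invr_ge0; lra.
  - move=> u uI; have /andP[u0 ul] : 0 < u < lambda by rewrite in_itv in uI.
    have deu := de _ uI.
    have dFu := dF u0.
    have dV : is_derive u 1 (fun y : R => y^-1) (- u ^- 2 *: 1).
      by apply: is_deriveV; rewrite gt_eqF.
    apply: is_derive_eq.
    rewrite /GRing.scale/= /f /g Phi_solve ?lt_eqF//; field.
    by rewrite p_neq0 !subr_eq0 (gt_eqF ul) (lt_eqF ul) (gt_eqF u0).
  - rewrite -[X in _ --> X]mulr1; apply: cvgM.
      by apply: cvgMl; apply: cvgN.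
    have -> : 1 = expR (- 0) :> R by rewrite oppr0 expR0.
    apply: expR_cvg; apply: cvgN.
    have l0 := lambda_gt0.
    by apply: (@integral_right_cvg0 _ _ _ (lambda / 2)); [lra|apply: ig; lra].
  - apply: (@bounded_mul_cvg0 _ _ _ _ _ p^-1).
      near=> u.
      have u0 : 0 < u by near: u; exact: nbhs_left_gt.
      have /andP[Fu0 Fu] := F_bound u0.
      rewrite !normrM normrN !gtr0_norm ?invr_gt0 ?divr_gt0//.
      by rewrite ler_piMl ?invr_ge0 ?(ltW p_gt0)// ler_pdivrMr// mul1r.
    have l0 := lambda_gt0.
    have PBl := PhiB_gt0 lambda_gt0.
    have PBl1 := PhiB_le1 lambda_gt0.
    have lP0 : 0 < lambda * PhiB lambda by rewrite mulr_gt0.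
    have lP1 : lambda * PhiB lambda <= lambda by rewrite ler_piMr// ltW.
    (* Unlike [lambda * h], the rate [g] may be negative away from lambda. For [u > a],
       [u - lambda + lambda * PhiB u] exceeds [lambda * PhiB lambda / 2], which leaves a residue of
       at least [PhiB lambda / 2]. *)
    pose a := lambda - lambda * PhiB lambda / 2.
    have sub (u : R) : u \in `]a, lambda[ -> u \in `]0, lambda[.
      by rewrite !in_itv/= /a => /andP[h1 ->]; rewrite andbT; lra.
    apply: (@expRN_cvg0_left R K g a lambda (PhiB lambda / 2)).
    + by rewrite /a; lra.
    + by rewrite divr_gt0.
    + by move=> u /sub; exact: dK.
    + move=> u uI; have := sub _ uI; move: uI; rewrite !in_itv/= => /andP[au ul] /andP[u0 _].
      rewrite gE// ler_pM2r ?invr_gt0 ?subr_gt0//.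
      have -> : 1 - lambda * ((1 - PhiB u) / u) = (u - lambda + lambda * PhiB u) / u.
        by field; rewrite gt_eqF.
      rewrite ler_pdivlMr//.
      have h1 : PhiB lambda / 2 * u <= PhiB lambda / 2 * lambda.
        by rewrite ler_pM2l ?divr_gt0// ltW.
      have h2 : lambda * PhiB lambda <= lambda * PhiB u.
        by rewrite ler_pM2l//; apply: PhiB_nincr => //; exact: ltW.
      by rewrite /a in au; lra.
rewrite /p_infty /oint (ltW lambda_gt0) /Rintegral.
rewrite (_ : (\int[mu]_(x in `[0%R, lambda]) _)%E =
             (\int[mu]_(x in `[0%R, lambda]) (f x)%:E)%E); last first.
  by apply: eq_integral => u /set_mem/=; rewrite in_itv/= => /andP[-> ul].
by rewrite fE/= sub0r mulNr opprK mul1r invrK.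
Unshelve. all: by end_near. Qed.

Lemma ode_formula (s : R) : 0 < s -> s != lambda ->
  Phi s = p_infty lambda PhiB / (s - lambda) *
    (s - lambda * PhiB s / s * oint lambda s (fun u => u / (u - lambda) *
      expR (lambda * oint u s (fun t => PhiB t / (t * (lambda - t)))))).
Proof.
move=> s0 sl; rewrite -ode_p_inftyE Phi_solve//.
have -> : F s = p * oint lambda s (fun u => u / (u - lambda) *
    expR (lambda * oint u s (fun t => PhiB t / (t * (lambda - t))))).
  by move: sl; rewrite neq_lt => /orP[/ode_solution_lt|/ode_solution_gt]; exact.
by set I := oint _ _ _; ring.
Qed.

End linear_ode.

(** * Laplace transforms *)

Section laplace_transform.
Context {d : measure_display} {T : measurableType d} {R : realType}.
Variable P : probability T R.
Local Notation mu := (@lebesgue_measure R).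

Definition laplace (X : T -> R) (s : R) : R := \int[P]_x expR (- (s * X x)).

Variable X : T -> R.
Hypothesis mX : measurable_fun setT X.
Hypothesis X_ge0 : forall x, 0 <= X x.

Lemma measurable_laplace_fun (s : R) :
  measurable_fun setT (fun x => expR (- (s * X x))).
Proof.
apply: measurableT_comp => //; apply: measurableT_comp => //.
exact: measurable_funM.
Qed.

Lemma laplace_fun_bound (s : R) x : 0 <= s -> 0 <= expR (- (s * X x)) <= 1.
Proof. by move=> s0; rewrite expR_ge0/= -expR0 ler_expR oppr_le0 mulr_ge0. Qed.

Lemma integrable_cst_prob (c : R) : P.-integrable setT (EFin \o cst c).
Proof. exact: finite_measure_integrable_cst. Qed.

Lemma Rintegral_cst_prob (c : R) : \int[P]_x c = c.
Proof.
rewrite /Rintegral integral_cst// -[X in (_ * X)%E]/(P [set: T]).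
by rewrite probability_setT mule1.
Qed.

Lemma laplace_fun_integrable (s : R) : 0 <= s ->
  P.-integrable setT (fun x => (expR (- (s * X x)))%:E).
Proof.
move=> s0; apply: (le_integrable _ _ _ (integrable_cst_prob 1)) => //.
  by apply/measurable_EFinP; exact: measurable_laplace_fun.
move=> x _ /=; rewrite lee_fin normr1 ger0_norm ?expR_ge0//.
by have /andP[] := laplace_fun_bound x s0.
Qed.

Lemma laplace_ge0 s : 0 <= laplace X s.
Proof. by apply: Rintegral_ge0 => x _; exact: expR_ge0. Qed.

Lemma laplace_le1 s : 0 <= s -> laplace X s <= 1.
Proof.
move=> s0; rewrite -[leRHS]Rintegral_cst_prob; apply: le_Rintegral => //.
- exact: laplace_fun_integrable.
- exact: integrable_cst_prob.
- by move=> x _; have /andP[] := laplace_fun_bound x s0.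
Qed.

Lemma laplace_nincr s t : 0 <= s -> s <= t -> laplace X t <= laplace X s.
Proof.
move=> s0 st; apply: le_Rintegral => //.
- by apply: laplace_fun_integrable; exact: le_trans st.
- exact: laplace_fun_integrable.
- by move=> x _; rewrite ler_expR lerN2 ler_wpM2r.
Qed.

(** If the integral were zero, the strictly positive integrand would vanish almost everywhere and
    the whole space would be null. *)
Lemma laplace_gt0 s : 0 <= s -> 0 < laplace X s.
Proof.
move=> s0; rewrite lt_neqAle laplace_ge0 andbT; apply/negP => /eqP/esym L0.
have : (\int[P]_x `|(expR (- (s * X x)))%:E| = 0)%E.
  under eq_integral do rewrite gee0_abs ?lee_fin ?expR_ge0//.
  have /integrable_fin_num : P.-integrable setT (fun x => (expR (- (s * X x)))%:E).
    exact: laplace_fun_integrable.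
  by move=> /(_ measurableT) /fineK <-; rewrite -[fine _]/(laplace X s) L0.
move=> /ae_eq_integral_abs -[//||N [mN N0 sub]].
  by apply/measurable_EFinP; exact: measurable_laplace_fun.
have : (P setT <= P N)%E.
  apply: le_measure; rewrite ?inE// => x _; apply: sub => /= /(_ I) [] /eqP.
  by rewrite gt_eqF ?expR_gt0.
by rewrite probability_setT N0 lee_fin ler10.
Qed.

(** The inequality [1 - expR (- x) <= x] under the expectation; it controls the integrand of
    [p_infty] at 0. *)
Lemma laplace_mean t : 0 <= t -> (\int[P]_x (X x)%:E < +oo)%E ->
  1 - laplace X t <= fine (\int[P]_x (X x)%:E)%E * t.
Proof.
move=> t0 EX.
have iX : P.-integrable setT (EFin \o X).
  apply/integrableP; split; first exact/measurable_EFinP.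
  by under eq_integral do rewrite /= ger0_norm//.
rewrite mulrC -[fine _]/(\int[P]_x X x) -RintegralZl//.
rewrite -{1}(Rintegral_cst_prob 1) -RintegralB//; last 2 first.
- exact: integrable_cst_prob.
- exact: laplace_fun_integrable.
apply: le_Rintegral => //.
- have -> : EFin \o (fun x => 1 - expR (- (t * X x))) =
      ((EFin \o cst 1%R) \- (fun x => (expR (- (t * X x)))%:E))%E by [].
  apply: integrableB => //; first exact: integrable_cst_prob.
  exact: laplace_fun_integrable.
- by apply: (@integrableZl _ _ _ _ _ _ t (EFin \o X)).
- move=> x _; rewrite lerBlDr -lerBlDl.
  exact: expR_ge1Dx.
Qed.

(* The absolute value keeps the integrand bounded by [1] around [0]. *)
Lemma laplace_norm_continuous : continuous (fun s : R => laplace X `|s|).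
Proof.
move=> s.
have := @continuity_under_integral R d T P (fun (s : R) x => expR (- (`|s| * X x)))
  setT measurableT (s - 1) (s + 1).
move=> /(_ _ _ (cst 1) _ _) H.
suff: {in `](s - 1)%R, (s + 1)%R[%classic,
    continuous (fun l : R => \int[P]_x expR (- (`|l| * X x)))}.
  by apply; rewrite inE /= in_itv/=; apply/andP; split; lra.
apply: H.
- by move=> x _; exact: laplace_fun_integrable.
- apply: aeW => x _ t _; apply: expR_cvg; apply: cvgN; apply: cvgMl.
  exact: norm_continuous.
- exact: integrable_cst_prob.
- move=> t _; apply: aeW => x _.
  rewrite ger0_norm ?expR_ge0//.
  by have /andP[] := laplace_fun_bound x (normr_ge0 t).
Qed.

Lemma laplace_continuous t : 0 < t -> {for t, continuous (laplace X)}.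
Proof.
move=> t0; have := @laplace_norm_continuous t.
rewrite /prop_for /continuous_at (gtr0_norm t0).
apply: cvg_trans; apply: near_eq_cvg; near=> x.
by rewrite gtr0_norm//; near: x; exact: lt_nbhsr.
Unshelve. all: by end_near. Qed.

Lemma laplace0 : laplace X 0 = 1.
Proof.
rewrite /laplace; under eq_Rintegral do rewrite mul0r oppr0 expR0.
exact: Rintegral_cst_prob.
Qed.

Lemma laplace_cvg0 : laplace X t @[t --> 0^'+] --> (1 : R).
Proof.
have := @laplace_norm_continuous 0.
rewrite /continuous_at normr0 laplace0 => /cvg_at_right_filter.
apply: cvg_trans; apply: near_eq_cvg; near=> x.
by rewrite gtr0_norm.
Unshelve. all: by end_near. Qed.

Definition laplace_prim (s : R) : R := \int[mu]_(t in `[0, s]) laplace X t.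

Lemma laplace_integrable (b : R) : mu.-integrable `[0, b] (EFin \o laplace X).
Proof.
have : mu.-integrable `[0, b] (EFin \o (fun t : R => laplace X `|t|)).
  by apply: continuous_itvcc_integrable => t _; exact: laplace_norm_continuous.
apply: eq_integrable => // t /set_mem/=; rewrite in_itv/= => /andP[t0 _].
by rewrite (ger0_norm t0).
Qed.

Lemma is_derive_laplace_prim (s : R) : 0 < s ->
  is_derive s 1 laplace_prim (laplace X s).
Proof.
move=> s0; apply: (@is_derive_integral_right _ _ _ (s + 1)).
- exact: laplace_integrable.
- exact: laplace_continuous.
- by rewrite s0 ltrDl ltr01.
Qed.

Let Rintegral_cst_itv (s c : R) : 0 <= s -> \int[mu]_(t in `[0, s]) c = s * c.
Proof.
move=> s0; rewrite Rintegral_cst//.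
have E : lebesgue_measure (`[0, s]%classic : set R) = s%:E.
  rewrite lebesgue_measure_itv/= lte_fin; case: ltgtP s0 => //= [s0 _|<- _//].
  by rewrite oppr0 adde0.
transitivity (c * fine s%:E); last by rewrite mulrC.
by congr (_ * fine _); exact: E.
Qed.

Let integrable_cst_itv (s c : R) : mu.-integrable `[0, s] (EFin \o cst c).
Proof. by apply: continuous_itvcc_integrable => x _; exact: cvg_cst. Qed.

Lemma laplace_prim_bound (s : R) : 0 <= s ->
  s * laplace X s <= laplace_prim s <= s.
Proof.
move=> s0; apply/andP; split.
  rewrite -(@Rintegral_cst_itv s (laplace X s) s0); apply: le_Rintegral => //.
  - exact: integrable_cst_itv.
  - exact: laplace_integrable.
  - by move=> t /=; rewrite in_itv/= => /andP[t0 ts]; exact: laplace_nincr.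
rewrite -[leRHS]mulr1 -(@Rintegral_cst_itv s 1 s0); apply: le_Rintegral => //.
- exact: laplace_integrable.
- exact: integrable_cst_itv.
- by move=> t /=; rewrite in_itv/= => /andP[t0 ts]; exact: laplace_le1.
Qed.

Lemma laplace_prim_slope0 : laplace_prim s / s @[s --> 0^'+] --> (1 : R).
Proof.
apply: (@squeeze_cvgr _ _ _ _ (laplace X) (cst 1)).
- near=> s.
  have s0 : 0 < s by [].
  have /andP[h1 h2] := laplace_prim_bound (ltW s0).
  by rewrite ler_pdivlMr// mulrC h1/= ler_pdivrMr// mul1r.
- exact: laplace_cvg0.
- exact: cvg_cst.
Unshelve. all: by end_near. Qed.

(** The substitution [t = s * v]. Averaging over a uniform factor [v] is what brings a primitive of
    the transform into the recursion. *)
Lemma laplace_scale_integral (s : R) : 0 < s ->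
  (\int[mu]_(v in `[0%R, 1%R]) (laplace X (s * v))%:E = (laplace_prim s / s)%:E)%E.
Proof.
move=> s0; rewrite (@ge0_FTC2_itvoo _ _ (fun v => laplace_prim (s * v) / s) 0 1 0
  (laplace_prim s / s)).
- by rewrite subr0.
- exact: ltr01.
- move=> v; rewrite in_itv/= => /andP[v0 v1].
  apply: (@continuous_comp _ _ _ (fun v : R => s * v) (laplace X)).
    by apply: cvgMr; exact: cvg_id.
  by apply: laplace_continuous; rewrite mulr_gt0.
- by move=> v _; exact: laplace_ge0.
- move=> v; rewrite in_itv/= => /andP[v0 v1].
  have sv0 : 0 < s * v by rewrite mulr_gt0.
  have dF := is_derive_laplace_prim sv0.
  have ds : is_derive v 1 (fun v : R => s * v) s.
    by rewrite -[X in is_derive _ _ _ X]mulr1; exact: is_deriveZ.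
  have dc : is_derive v 1 (fun v => laplace_prim (s * v)) (laplace X (s * v) * s).
    exact: (@is_derive1_comp R laplace_prim (fun v => s * v)).
  have -> : (fun v => laplace_prim (s * v) / s) = (fun v => s^-1 *: laplace_prim (s * v)).
    by apply/funext => x; rewrite mulrC.
  have -> : laplace X (s * v) = s^-1 *: (laplace X (s * v) * s).
    by rewrite /GRing.scale/= [RHS]mulrC -mulrA divff ?mulr1// gt_eqF.
  exact: is_deriveZ.
- rewrite -[X in _ --> X](mul0r s^-1); apply: cvgMl.
  apply: (@squeeze_cvgr _ _ _ _ (cst 0) (fun v => s * v)).
  + near=> v.
    have v0 : 0 < v by [].
    have sv0 : 0 <= s * v by rewrite mulr_ge0 ?ltW.
    have /andP[h1 ->] := laplace_prim_bound sv0.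
    by rewrite andbT (le_trans _ h1)// mulr_ge0// laplace_ge0.
  + exact: cvg_cst.
  + rewrite -[X in _ --> X](mulr0 s); apply: cvgMr.
    by apply: cvg_at_right_filter; exact: cvg_id.
- apply: cvgMl; apply: cvg_at_left_filter.
  rewrite -[X in _ --> laplace_prim X](mulr1 s).
  apply: (@continuous_comp _ _ _ (fun v : R => s * v) laplace_prim).
    by apply: cvgMr; exact: cvg_id.
  by rewrite mulr1; exact: is_derive_cont (is_derive_laplace_prim s0).
Unshelve. all: by end_near. Qed.

End laplace_transform.

(** The [B i] are non-negative only almost surely, while the lemmas on [laplace] assume it
    everywhere; the positive part repairs the null set. *)
Lemma LST_laplace {d : measure_display} {T : measurableType d} {R : realType}
    (P : probability T R) (X : {RV P >-> R}) : {ae P, forall x, 0 <= X x} ->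
  LST X = laplace P (fun x => Num.max (X x) 0).
Proof.
move=> X0; apply/funext => s; rewrite /LST /mmt_gen_fun unlock /laplace /Rintegral.
congr fine; apply: ae_eq_integral => //.
- by apply/measurable_EFinP; exact: measurableT_comp.
- apply/measurable_EFinP.
  apply: (@measurable_laplace_fun _ _ _ (fun x => Num.max (X x) 0)).
  by apply: measurable_maxr => //; exact: measurable_cst.
- apply: filterS X0 => x Xx _ /=; rewrite max_l//.
  by rewrite mulrN mulrC.
Qed.

(** * Independence *)

Section independence_calculus.
Context {d : measure_display} {T : measurableType d} {R : realType}.
Variable P : probability T R.
Local Open Scope ereal_scope.

Definition RV_of (f : T -> R) (mf : measurable_fun setT f) : {RV P >-> R} :=
  mfun_Sub (mem_set mf).

Definition RV_pair (X Y : {RV P >-> R}) : {RV P >-> (R * R)%type} :=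
  mfun_Sub (mem_set (measurable_fun_pair (measurable_funPT X) (measurable_funPT Y))).

Definition RV_map2 (g : (R * R)%type -> R) (mg : measurable_fun setT g)
    (X Y : {RV P >-> R}) : {RV P >-> R} :=
  RV_of (measurableT_comp mg (measurable_funPT (RV_pair X Y))).

Definition same_law (X Y : {RV P >-> R}) :=
  forall D : set R, measurable D -> distribution P X D = distribution P Y D.

Definition indep2 (X Y : {RV P >-> R}) :=
  forall D E : set R, measurable D -> measurable E ->
    P (X @^-1` D `&` Y @^-1` E) = P (X @^-1` D) * P (Y @^-1` E).

(** On rectangles the joint law restricted to [H] is the product of the law of [X] and of the law of
    [Y] scaled by [P H]; uniqueness of the product measure extends this to all [B]. *)
Lemma restr_joint_law (X Y : {RV P >-> R}) (H : set T) : measurable H ->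
  (forall D E : set R, measurable D -> measurable E ->
    P (X @^-1` D `&` Y @^-1` E `&` H) = P (X @^-1` D) * P (Y @^-1` E) * P H) ->
  forall B : set (R * R)%type, measurable B ->
    P (RV_pair X Y @^-1` B `&` H) =
    (distribution P X \x distribution P Y) B * P H.
Proof.
move=> mH XYH B mB.
pose c : {nonneg R} := NngNum (fine_ge0 (measure_ge0 P H)).
have cE : c%:num%:E = P H by rewrite /= fineK// fin_num_measure.
pose m2 := mscale c (distribution P Y).
pose m' := pushforward (mrestr P mH) (RV_pair X Y).
have m'E (D E : set R) : measurable D -> measurable E ->
    m' (D `*` E) = distribution P X D * m2 E.
  move=> mD mE; rewrite /m2 /= /mscale cE /m' /pushforward /mrestr/=.
  by rewrite XYH// muleCA muleC muleA.
transitivity ((distribution P X \x m2) B).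
  exact/esym/(product_measure_unique m'E mB).
rewrite /product_measure1 -ge0_integralZr//=.
  apply: eq_integral => x _ /=.
  by rewrite /m2 /= /mscale cE muleC.
exact: measurable_fun_xsection.
Qed.

Lemma joint_law (X Y : {RV P >-> R}) : indep2 X Y ->
  forall B : set (R * R)%type, measurable B ->
    distribution P (RV_pair X Y) B = (distribution P X \x distribution P Y) B.
Proof.
move=> XY B mB.
have XYT (D E : set R) : measurable D -> measurable E ->
    P (X @^-1` D `&` Y @^-1` E `&` setT) =
    P (X @^-1` D) * P (Y @^-1` E) * P [set: T].
  by move=> mD mE; rewrite setIT probability_setT mule1; exact: XY.
by have := restr_joint_law measurableT XYT mB; rewrite setIT probability_setT mule1.
Qed.

Lemma integral_indep2 (X Y : {RV P >-> R}) (g : (R * R)%type -> \bar R) :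
  indep2 X Y -> measurable_fun setT g -> (forall z, 0 <= g z) ->
  \int[P]_x g (X x, Y x) =
  \int[distribution P X]_x \int[distribution P Y]_y g (x, y).
Proof.
move=> XY mg g0.
rewrite -(@fubini_tonelli1 _ _ _ _ _ (distribution P X) (distribution P Y) g)//.
rewrite (eq_measure_integral (distribution P (RV_pair X Y))); last first.
  by move=> A mA _; apply/esym; exact: joint_law.
by rewrite ge0_integral_distribution.
Qed.

Lemma same_law_map2 (g : (R * R)%type -> R) (mg : measurable_fun setT g)
    (X X' Y Y' : {RV P >-> R}) :
  indep2 X Y -> indep2 X' Y' -> same_law X X' -> same_law Y Y' ->
  same_law (RV_map2 mg X Y) (RV_map2 mg X' Y').
Proof.
move=> XY XY' XX YY D mD.
have mB : measurable (g @^-1` D) by rewrite -[X in measurable X]setTI; exact: mg.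
transitivity (distribution P (RV_pair X Y) (g @^-1` D)); first by [].
transitivity (distribution P (RV_pair X' Y') (g @^-1` D)); last by [].
rewrite !joint_law// /product_measure1.
rewrite (eq_measure_integral (distribution P X')); last by move=> A mA _; exact: XX.
apply: eq_integral => x _ /=; apply: YY.
exact: measurable_xsection.
Qed.

Lemma same_law_integral (X Y : {RV P >-> R}) (f : R -> \bar R) :
  same_law X Y -> measurable_fun setT f -> (forall x, 0 <= f x) ->
  \int[P]_x f (X x) = \int[P]_x f (Y x).
Proof.
move=> XY mf f0; rewrite -!ge0_integral_distribution//.
by apply: eq_measure_integral => A mA _; exact: XY.
Qed.

Variables (I : eqType) (U : I -> {RV P >-> R}).

(* [X] is independent of the joint behaviour of the [U j] with [j] outside [S]. *)
Definition indep_off (S : {pred I}) (X : {RV P >-> R}) :=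
  forall (J : seq I) (E : I -> set R) (D : set R),
    uniq J -> {in J, forall j, j \notin S} ->
    (forall j, measurable (E j)) -> measurable D ->
    P (X @^-1` D `&` \bigcap_(j in [set` J]) (U j @^-1` E j)) =
    P (X @^-1` D) * \prod_(j <- J) P (U j @^-1` E j).

Lemma indep_off_sub (S S' : {pred I}) (X : {RV P >-> R}) :
  {subset S <= S'} -> indep_off S X -> indep_off S' X.
Proof.
move=> SS' XS J E D uJ JS; apply: XS => // j /JS.
by apply: contra => /SS'.
Qed.

Lemma indep_off_indep2 (S : {pred I}) (X : {RV P >-> R}) i :
  indep_off S X -> i \notin S -> indep2 X (U i).
Proof.
move=> XS iS D E mD mE.
have := XS [:: i] (fun=> E) D; rewrite big_seq1 => <- //.
  congr (P (_ `&` _)); apply/seteqP; split=> [x Ex j /=|x /(_ i)].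
    by rewrite inE => /eqP ->.
  by apply; rewrite /= inE.
by move=> j; rewrite inE => /eqP ->.
Qed.

(** Let [H] be an event on inputs outside [S] and other than [i]. Restricted to [H], the pair of [X]
    and [U i] keeps its product law up to the factor [P H], so any function of the pair is
    independent of [H]. The index [i] has been consumed and joins [S]. *)
Lemma indep_off_map2 (g : (R * R)%type -> R) (mg : measurable_fun setT g)
    (S : {pred I}) (X : {RV P >-> R}) i :
  indep_off S X -> i \notin S ->
  indep_off [predU1 i & S] (RV_map2 mg X (U i)).
Proof.
move=> XS iS J E D uJ JS mE mD.
pose H := \bigcap_(j in [set` J]) (U j @^-1` E j).
have mH : measurable H.
  apply: fin_bigcap_measurable; first exact: finite_seq.
  by move=> j _; exact: measurable_funPTI.
have JnS : {in J, forall j, j \notin S}.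
  by move=> j /JS; rewrite !inE negb_or => /andP[].
have iJ : i \notin J.
  by apply/negP => /JS; rewrite !inE eqxx.
have PH : P H = \prod_(j <- J) P (U j @^-1` E j).
  have := XS J E setT uJ JnS mE measurableT.
  by rewrite preimage_setT setTI probability_setT mul1e.
have mB : measurable (g @^-1` D) by rewrite -[X in measurable X]setTI; exact: mg.
have Xi : indep2 X (U i) by exact: indep_off_indep2 XS iS.
transitivity (P (RV_pair X (U i) @^-1` (g @^-1` D) `&` H)); first by [].
rewrite (restr_joint_law mH)//; last first.
  move=> D' E' mD' mE'.
  (* Independence is applied to the list extended by [i], with [E'] as the event at [i]. *)
  have := XS (i :: J) (fun j => if j == i then E' else E j) D'.
  rewrite big_cons eqxx => h.
  transitivity (P (X @^-1` D') * (P (U i @^-1` E') * P H)); last by rewrite muleA.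
  rewrite -setIA PH.
  have -> : \prod_(j <- J) P (U j @^-1` E j) =
      \prod_(j <- J) P (U j @^-1` (if j == i then E' else E j)).
    apply: eq_big_seq => j jJ; case: eqVneq => // ji.
    by rewrite -ji jJ in iJ.
  rewrite -h//.
  - congr (P (_ `&` _)); apply/seteqP; split=> [x [xE xH] j /=|x xH].
      rewrite inE => /predU1P[->|jJ]; first by rewrite eqxx.
      case: eqVneq => [ji|_]; first by rewrite -ji jJ in iJ.
      exact: xH.
    split; first by have := xH i; rewrite eqxx; apply; rewrite /= inE eqxx.
    move=> j jJ; have := xH j; case: eqVneq => [ji|_].
      by rewrite -ji jJ in iJ.
    by apply; rewrite /= inE jJ orbT.
  - by rewrite /= iJ.
  - by move=> j; rewrite inE => /predU1P[->//|/JnS].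
  - by move=> j; case: ifP.
by rewrite -joint_law// PH.
Qed.

End independence_calculus.

Section flatten_independence.
Context {d : measure_display} {T : measurableType d} {R : realType}.
Variable P : probability T R.
Local Open Scope ereal_scope.
Variable X : 'I_3 -> nat -> {RV P >-> R}.

Lemma sigma_seq_bigcap (Y : nat -> {RV P >-> R}) (J : seq nat) (E : nat -> set R) :
  (forall n, measurable (E n)) ->
  sigma_seq Y (\bigcap_(n in [set` J]) (Y n @^-1` E n)).
Proof.
move=> mE.
have mY n : <<s \bigcup_n g_sigma_algebra_preimage (Y n) >> (Y n @^-1` E n).
  by apply: sub_sigma_algebra; exists n => //; exists (E n) => //; rewrite setTI.
rewrite /sigma_seq bigcap_seq.
elim: J => [|n J IH].
  by rewrite big_nil; exact: (@measurableT _ (g_sigma_algebraType _)).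
rewrite big_cons.
by apply: (@measurableI _ (g_sigma_algebraType (\bigcup_n g_sigma_algebra_preimage (Y n))));
  [exact: mY|exact: IH].
Qed.

Hypothesis X_indep : forall k, mutually_independent P
  (fun n => g_sigma_algebra_preimage (X k n)).
Hypothesis seq_indep : mutually_independent P (fun k => sigma_seq (X k)).

(** Grouping [J] by sequence writes the event as an intersection of three cylinders: [seq_indep]
    separates them, and [X_indep] then factors each one. *)
Lemma flatten_indep (J : seq (nat * 'I_3)) (E : nat * 'I_3 -> set R) :
  uniq J -> (forall j, measurable (E j)) ->
  P (\bigcap_(j in [set` J]) (X j.2 j.1 @^-1` E j)) =
  \prod_(j <- J) P (X j.2 j.1 @^-1` E j).
Proof.
move=> uJ mE.
pose Jk (k : 'I_3) := [seq j.1 | j <- J & j.2 == k].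
pose G k := \bigcap_(n in [set` Jk k]) (X k n @^-1` E (n, k)).
have memJk n k : (n \in Jk k) = ((n, k) \in J).
  apply/mapP/idP => [[[n' k'] + /= ->]|nkJ].
    by rewrite mem_filter /= => /andP[/eqP <-].
  by exists (n, k) => //; rewrite mem_filter /= eqxx.
have uJk k : uniq (Jk k).
  rewrite map_inj_in_uniq ?filter_uniq// => -[a b] [a' b'].
  by rewrite !mem_filter /= => /andP[/eqP -> _] /andP[/eqP -> _] ->.
have -> : \bigcap_(j in [set` J]) (X j.2 j.1 @^-1` E j) =
    \bigcap_(k in [set` enum 'I_3]) G k.
  apply/seteqP; split=> [x xJ k _ n /=|x xG [n k] /= nkJ].
    by rewrite memJk => /xJ.
  have := xG k; rewrite /= mem_enum => /(_ isT) /(_ n) /=.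
  by rewrite memJk; exact.
rewrite seq_indep ?enum_uniq//; last first.
  by move=> k _; apply: (@sigma_seq_bigcap (X k) _ (fun n => E (n, k))).
rewrite (partition_big (fun j => j.2) xpredT)//= big_enum/=.
apply: eq_bigr => k _.
rewrite (X_indep (k := k) (E := fun n => X k n @^-1` E (n, k)) (uJk k)); last first.
  by move=> n _; exists (E (n, k)) => //; rewrite setTI.
rewrite big_map big_filter; apply: eq_bigr => -[n k'] /= /eqP ->.
by [].
Qed.

End flatten_independence.

(** * Forward and backward iterates *)

Section backward_iterates.
Context {d : measure_display} {T : measurableType d} {R : realType}.
Variable P : probability T R.
Variables V A B : nat -> {RV P >-> R}.
Local Open Scope ereal_scope.

(** A single family indexed by time and sequence, with [V], [A], [B] numbered 0, 1, 2, in which the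
    inputs a state has used form a set of indices. *)
Definition inputs (j : nat * 'I_3) : {RV P >-> R} := tnth [tuple V; A; B] j.2 j.1.

Let iV (n : nat) : nat * 'I_3 := (n, @Ordinal 3 0 isT).
Let iA (n : nat) : nat * 'I_3 := (n, @Ordinal 3 1 isT).
Let iB (n : nat) : nat * 'I_3 := (n, @Ordinal 3 2 isT).

Definition pair_mul (z : R * R) : R := (z.2 * z.1)%R.
Definition pair_add (z : R * R) : R := (z.1 + z.2)%R.
Definition pair_sub_pos (z : R * R) : R := Num.max (z.1 - z.2)%R 0%R.

Lemma measurable_pair_mul : measurable_fun setT pair_mul.
Proof. exact: measurable_funM. Qed.

Lemma measurable_pair_add : measurable_fun setT pair_add.
Proof. exact: measurable_funD. Qed.

Lemma measurable_pair_sub_pos : measurable_fun setT pair_sub_pos.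
Proof. by apply: measurable_maxr => //; exact: measurable_funB. Qed.

Definition workload (X Y Z : {RV P >-> R}) : {RV P >-> R} :=
  RV_map2 measurable_pair_add (RV_map2 measurable_pair_mul X Y) Z.

Definition step (X Y Z Z' : {RV P >-> R}) : {RV P >-> R} :=
  RV_map2 measurable_pair_sub_pos (workload X Y Z) Z'.

Lemma workloadE (X Y Z : {RV P >-> R}) x : workload X Y Z x = (Y x * X x + Z x)%R.
Proof. by []. Qed.

Variable w : R.

(** With [f_k] the map of step [k], the maps [f_k], ..., [f_(k + n - 1)] are applied to [w], [f_k]
    being outermost. The starting time [k] varies because the recursion on [n] peels off the
    outermost map. *)
Fixpoint backward (k n : nat) : {RV P >-> R} :=
  if n is n.+1 then step (backward k.+1 n) (V k) (B k) (A k)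
  else RV_of P (@measurable_cst _ _ T R setT w).

(** Absolute values make the increments non-negative at every point, although [V] and [B] are so
    only almost surely. *)
Definition pair_abs_add (z : R * R) : R := (`|z.1| + `|z.2|)%R.

Lemma measurable_pair_abs_add : measurable_fun setT pair_abs_add.
Proof. by apply: measurable_funD; exact: measurableT_comp. Qed.

Definition pair_abs_mul (z : R * R) : R := (`|z.2| * `|z.1|)%R.

Lemma measurable_pair_abs_mul : measurable_fun setT pair_abs_mul.
Proof. by apply: measurable_funM; exact: measurableT_comp. Qed.

(* Dominates the increment [backward k n.+1 - backward k n]. *)
Fixpoint increment (k n : nat) : {RV P >-> R} :=
  if n is n.+1 then RV_map2 measurable_pair_abs_mul (increment k.+1 n) (V k)
  else RV_map2 measurable_pair_abs_add (RV_of P (@measurable_cst _ _ T R setT w)) (B k).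

Lemma backward0E k x : backward k 0 x = w.
Proof. by []. Qed.

Lemma backwardSE k n x : backward k n.+1 x =
  Num.max (V k x * backward k.+1 n x + B k x - A k x)%R 0%R.
Proof. by []. Qed.

Lemma increment0E k x : increment k 0 x = (`|w| + `|B k x|)%R.
Proof. by []. Qed.

Lemma incrementSE k n x : increment k n.+1 x = (`|V k x| * `|increment k.+1 n x|)%R.
Proof. by []. Qed.

Hypothesis V_iid : iid V.
Hypothesis A_iid : iid A.
Hypothesis B_iid : iid B.
Hypothesis VAB_indep : independent_sequences V A B.

Lemma inputs_indep (J : seq (nat * 'I_3)) (E : nat * 'I_3 -> set R) :
  uniq J -> (forall j, measurable (E j)) ->
  P (\bigcap_(j in [set` J]) (inputs j @^-1` E j)) =
  \prod_(j <- J) P (inputs j @^-1` E j).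
Proof.
move=> uJ mE.
have kI k : mutually_independent P
    (fun n => g_sigma_algebra_preimage (tnth [tuple V; A; B] k n)).
  case: k => [[|[|[|//]]] lt_k3].
  - by rewrite (tnth_nth V)/=; case: V_iid.
  - by rewrite (tnth_nth V)/=; case: A_iid.
  - by rewrite (tnth_nth V)/=; case: B_iid.
exact: (flatten_indep kI VAB_indep uJ mE).
Qed.

Lemma indep_off_cst (c : R) (S : {pred nat * 'I_3}) :
  indep_off inputs S (RV_of P (@measurable_cst _ _ T R setT c)).
Proof.
move=> J E D uJ JS mE mD.
rewrite -inputs_indep//=.
have [Dc|Dc] := pselect (D c).
  have -> : cst c @^-1` D = [set: T] by apply/seteqP; split.
  by rewrite setTI probability_setT mul1e.
have -> : cst c @^-1` D = set0 :> set T by apply/seteqP; split.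
by rewrite set0I measure0 mul0e.
Qed.

Definition window (k m : nat) : {pred nat * 'I_3} := [pred j | k <= j.1 < m]%N.

(** The inputs [V k], [B k], [A k] are consumed in this order, each one lying outside the set of
    those already used. *)
Lemma step_indep (S : {pred nat * 'I_3}) (X : {RV P >-> R}) k :
  indep_off inputs S X -> (forall i, (k, i) \notin S) ->
  [/\ indep2 X (V k), indep2 (RV_map2 measurable_pair_mul X (V k)) (B k),
      indep2 (workload X (V k) (B k)) (A k) &
      indep_off inputs [pred j | (j \in S) || (j.1 == k)]
        (step X (V k) (B k) (A k))].
Proof.
move=> XS kS.
have VE : V k = inputs (iV k) by rewrite /inputs (tnth_nth V).
have AE : A k = inputs (iA k) by rewrite /inputs (tnth_nth V).
have BE : B k = inputs (iB k) by rewrite /inputs (tnth_nth V).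
have X1 := indep_off_map2 measurable_pair_mul XS (kS _ : iV k \notin S).
have ne (a b : 'I_3) : a != b -> (k, a) != (k, b) by rewrite xpair_eqE eqxx.
have BS1 : iB k \notin [predU1 iV k & S] by rewrite !inE negb_or kS andbT ne.
have X2 := indep_off_map2 measurable_pair_add X1 BS1.
have AS2 : iA k \notin [predU1 iB k & [predU1 iV k & S]].
  by rewrite !inE !negb_or kS andbT !ne.
have X3 := indep_off_map2 measurable_pair_sub_pos X2 AS2.
rewrite VE AE BE; split.
- exact: indep_off_indep2 XS (kS _).
- exact: indep_off_indep2 X1 BS1.
- exact: indep_off_indep2 X2 AS2.
- apply: indep_off_sub X3 => j; rewrite !inE.
  by move=> /or4P[/eqP ->|/eqP ->|/eqP ->|->//]; rewrite eqxx orbT.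
Qed.

Lemma backward_indep k n : indep_off inputs (window k (k + n)) (backward k n).
Proof.
elim: n k => [k|n IH k]; first exact: indep_off_cst.
have kW i : (k, i) \notin window k.+1 (k.+1 + n) by rewrite !inE /= ltnn.
have [_ _ _] := step_indep (IH k.+1) kW.
apply: indep_off_sub => -[j i]; rewrite !inE/= addnS addSn.
case/orP => [/andP[kj ->]|/eqP ->]; first by rewrite (ltnW kj).
by rewrite leqnn ltnS leq_addr.
Qed.

Lemma increment_indep k n : indep_off inputs (window k (k + n.+1)) (increment k n).
Proof.
elim: n k => [k|n IH k] /=.
  have BE : B k = inputs (iB k) by rewrite /inputs (tnth_nth V).
  have := indep_off_map2 measurable_pair_abs_add (@indep_off_cst w pred0)
    (isT : iB k \notin pred0).
  rewrite -BE; apply: indep_off_sub => -[j i]; rewrite !inE => /eqP[-> _].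
  by rewrite /= leqnn addn1 ltnS leqnn.
have VE : V k = inputs (iV k) by rewrite /inputs (tnth_nth V).
have kW : iV k \notin window k.+1 (k.+1 + n.+1) by rewrite !inE /= ltnn.
have := indep_off_map2 measurable_pair_abs_mul (IH k.+1) kW.
rewrite -VE; apply: indep_off_sub => -[j i]; rewrite !inE/= [in X in _ -> X]addnS -addSn.
case/orP => [/eqP[-> _]|/andP[kj ->]]; last by rewrite (ltnW kj).
by rewrite leqnn addSn ltnS leq_addr.
Qed.

Lemma increment_indep2 k n : indep2 (increment k.+1 n) (V k).
Proof.
have -> : V k = inputs (iV k) by rewrite /inputs (tnth_nth V).
apply: (indep_off_indep2 (@increment_indep k.+1 n)).
by rewrite !inE /= ltnn.
Qed.

Lemma same_law_step (X X' : {RV P >-> R}) (S S' : {pred nat * 'I_3}) k l :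
  indep_off inputs S X -> (forall i, (k, i) \notin S) ->
  indep_off inputs S' X' -> (forall i, (l, i) \notin S') ->
  same_law X X' ->
  same_law (step X (V k) (B k) (A k)) (step X' (V l) (B l) (A l)).
Proof.
move=> XS kS XS' lS XX.
have iidE (Y : nat -> {RV P >-> R}) m n : iid Y -> same_law (Y m) (Y n).
  by move=> [_ Y0] D mD; rewrite !Y0.
have [h1 h2 h3 _] := step_indep XS kS.
have [h1' h2' h3' _] := step_indep XS' lS.
apply: same_law_map2 => //; last exact: iidE.
apply: same_law_map2 => //; last exact: iidE.
by apply: same_law_map2 => //; exact: iidE.
Qed.

Variable W : nat -> {RV P >-> R}.
Hypothesis W0 : forall x, W 0%N x = w.
Hypothesis WS : forall i x, W i.+1 x = Num.max (V i x * W i x + B i x - A i x)%R 0%R.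

Lemma W_stepE n : W n.+1 = step (W n) (V n) (B n) (A n).
Proof. by apply/mfuneqP => x; rewrite WS. Qed.

Lemma forward_indep n : indep_off inputs (window 0 n) (W n).
Proof.
elim: n => [|n IH].
  have -> : W 0%N = RV_of P (@measurable_cst _ _ T R setT w) by apply/mfuneqP.
  exact: indep_off_cst.
have nW i : (n, i) \notin window 0 n by rewrite !inE /= ltnn.
have [_ _ _] := step_indep IH nW; rewrite -W_stepE.
apply: indep_off_sub => -[j i]; rewrite !inE/= ltnS.
by case/orP => [/ltnW//|/eqP ->].
Qed.

(** The forward iterate feeds [W n] with the inputs of time [n], the backward one feeds
    [backward k.+1 n] with those of time [k]. In both cases the state is independent of the fresh
    inputs, whose law does not depend on time. The induction is uniform in [k] because the starting
    time moves. *)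
Lemma same_law_forward_backward k n : same_law (W n) (backward k n).
Proof.
elim: n k => [|n IH] k.
  have -> : W 0%N = RV_of P (@measurable_cst _ _ T R setT w) by apply/mfuneqP.
  by [].
rewrite W_stepE /=.
apply: (same_law_step (@forward_indep n) _ (@backward_indep k.+1 n)) => // i;
  by rewrite !inE /= ltnn.
Qed.

End backward_iterates.

(** * Transforms of sums, uniform products and exponential reflections *)

Section transform_calculus.
Context {d : measure_display} {T : measurableType d} {R : realType}.
Variable P : probability T R.
Local Notation mu := (@lebesgue_measure R).
Local Open Scope ereal_scope.
Implicit Types X Y : {RV P >-> R}.

(* The measurable structure carried by [R] and the one on which [lebesgue_measure]
   is declared have the same sets but different displays. *)
Lemma measurable_Borel X : @measurable_fun _ _ T (measurableTypeR R) setT X.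
Proof. by move=> _ Y mY; apply: measurable_funPT. Qed.

Definition Borel_of X : {RV P >-> measurableTypeR R} :=
  @mfun_Sub _ _ T (measurableTypeR R) X (mem_set (measurable_Borel X)).

Lemma ge0_integral_Borel X (f : R -> \bar R) :
  measurable_fun setT f -> (forall x, 0 <= f x) ->
  \int[distribution P X]_x f x = \int[distribution P (Borel_of X)]_x f x.
Proof.
move=> mf f0; rewrite ge0_integral_distribution//.
by rewrite (@ge0_integral_distribution _ _ _ _ _ P (Borel_of X) f).
Qed.

Lemma ae_law0 X (E : set R) : measurable E -> distribution P X E = 0 ->
  {ae P, forall x, ~ E (X x)}.
Proof.
move=> mE XE; exists (X @^-1` E); split => //; first exact: measurable_funPTI.
by move=> x /= /contrapT.
Qed.

(** Extended-valued, so that Tonelli's theorem applies with no integrability to check. *)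
Definition elaplace (f : T -> R) (s : R) : \bar R := \int[P]_x (expR (- (s * f x)))%:E.

Lemma laplaceE (f : T -> R) s : laplace P f s = fine (elaplace f s).
Proof. by []. Qed.

Lemma elaplaceE (f : T -> R) (s : R) : measurable_fun setT f ->
  (forall x, 0 <= f x)%R -> (0 <= s)%R -> elaplace f s = (laplace P f s)%:E.
Proof.
move=> mf f0 s0; rewrite laplaceE fineK//.
exact/integrable_fin_num/laplace_fun_integrable.
Qed.

Let measurable_expRN (s : R) :
  measurable_fun setT (fun y : R => (expR (- (s * y)))%:E).
Proof. by apply/measurable_EFinP; exact: (@measurable_laplace_fun _ _ _ id). Qed.

Lemma elaplace_add X Y s : indep2 X Y ->
  elaplace (fun x => X x + Y x)%R s = elaplace X s * elaplace Y s.
Proof.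
move=> XY; rewrite /elaplace.
have mg : measurable_fun setT (fun z : R * R => (expR (- (s * (z.1 + z.2))))%:E).
  apply/measurable_EFinP.
  apply: (@measurable_laplace_fun _ _ _ (fun z : R * R => (z.1 + z.2)%R)).
  exact: measurable_funD.
have g0 (z : R * R) : 0 <= (expR (- (s * (z.1 + z.2))))%:E by rewrite lee_fin expR_ge0.
rewrite (integral_indep2 XY mg g0) /=.
transitivity (\int[distribution P X]_x ((expR (- (s * x)))%:E *
    \int[distribution P Y]_y (expR (- (s * y)))%:E)).
  apply: eq_integral => x _.
  rewrite -ge0_integralZl//.
  by apply: eq_integral => y _; rewrite mulrDr opprD expRD EFinM.
rewrite ge0_integralZr//; last by apply: integral_ge0.
by rewrite !ge0_integral_distribution.
Qed.

Lemma integral_uniform_law X (f : R -> \bar R) :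
  (forall E : set R, measurable E -> distribution P X E = uniform_prob (@ltr01 R) E) ->
  measurable_fun setT f -> (forall x, 0 <= f x) ->
  \int[distribution P X]_x f x = \int[mu]_(x in `[0%R, 1%R]) f x.
Proof.
move=> XU mf f0.
rewrite ge0_integral_Borel//.
transitivity (\int[uniform_prob (@ltr01 R)]_x f x).
  by apply: eq_measure_integral => A mA _; exact: XU.
by rewrite integral_uniform// subr0 invr1 mul1e.
Qed.

(** Tonelli's theorem puts the uniform variable outside: given [Y = v] the transform is that of [X]
    at [s * v], and [laplace_scale_integral] averages it over [v]. *)
Lemma elaplace_uniform_mul X Y s : (forall x, 0 <= X x)%R -> indep2 X Y ->
  (forall E : set R, measurable E -> distribution P Y E = uniform_prob (@ltr01 R) E) ->
  (0 < s)%R ->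
  elaplace (fun x => Y x * X x)%R s = (laplace_prim P X s / s)%:E.
Proof.
move=> X0 XY YU s0; rewrite /elaplace.
have mg : measurable_fun setT (fun z : R * R => (expR (- (s * (z.2 * z.1))))%:E).
  apply/measurable_EFinP.
  apply: (@measurable_laplace_fun _ _ _ (fun z : R * R => (z.2 * z.1)%R)).
  exact: measurable_funM.
have g0 (z : R * R) : 0 <= (expR (- (s * (z.2 * z.1))))%:E by rewrite lee_fin expR_ge0.
rewrite (integral_indep2 XY mg g0) /=.
rewrite (@fubini_tonelli _ _ _ _ _ (distribution P X) (distribution P Y)
  (fun z : R * R => (expR (- (s * (z.2 * z.1))))%:E))//=.
rewrite integral_uniform_law//; last 2 first.
- have := measurable_fun_fubini_tonelli_G (m1 := distribution P X) _ mg g0.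
  exact.
- by move=> y; apply: integral_ge0 => x _; rewrite lee_fin expR_ge0.
rewrite -laplace_scale_integral//.
apply: eq_integral => v /set_mem /=; rewrite in_itv/= => /andP[v0 v1].
rewrite -elaplaceE// ?mulr_ge0 ?(ltW s0)//.
rewrite /elaplace; transitivity (\int[distribution P X]_x (expR (- (s * v * x)))%:E).
  by apply: eq_integral => x _; rewrite mulrA.
by rewrite ge0_integral_distribution// => y; rewrite lee_fin expR_ge0.
Qed.

(** [nu] is dominated by Lebesgue measure, and its Radon-Nikodym derivative equals [p] almost
    everywhere because both have the same integral over every measurable set. *)
Lemma integral_density (nu : probability (measurableTypeR R) R) (p : R -> R)
    (f : R -> \bar R) :
  measurable_fun setT p -> (forall x, 0 <= p x)%R ->
  (forall E : set R, measurable E -> nu E = \int[mu]_(x in E) (p x)%:E) ->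
  nu.-integrable setT f ->
  \int[nu]_x f x = \int[mu]_x (f x * (p x)%:E).
Proof.
move=> mp p0 nuE intf.
have numu : nu `<< mu.
  apply/null_content_dominatesP => E mE E0; rewrite nuE//.
  by apply: null_set_integral => //; exact/measurable_EFinP/measurable_funTS.
rewrite -(Radon_Nikodym_change_of_variables numu)//=.
apply: ae_eq_integral => //.
- apply: emeasurable_funM; first exact: (measurable_int nu).
  by apply: (measurable_int mu); exact: Radon_Nikodym_integrable.
- apply: emeasurable_funM; first exact: (measurable_int nu).
  exact/measurable_EFinP.
- apply: ae_eqe_mul2l => /=.
  rewrite Radon_NikodymE//=.
  case: cid => /= h [h1 h2 h3].
  apply: integral_ae_eq => //=; first exact/measurable_EFinP.
  by move=> E _ mE; rewrite -h3//= nuE.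
Qed.

(** Only exponentials of [y] at the rates [s] and lambda come out, so the recursion on transforms
    closes up. The one at rate lambda is the probability that [A] exceeds [y], that is, that the
    next state is 0. *)
Lemma exponential_idle_transform (A : {RV P >-> R}) (lambda s y : R) :
  (0 < lambda)%R ->
  (forall E : set R, measurable E -> distribution P A E = exponential_prob lambda E) ->
  (0 < s)%R -> s != lambda -> (0 <= y)%R ->
  \int[distribution P A]_a (expR (- (s * Num.max (y - a) 0)))%:E =
  ((s * expR (- (lambda * y)) - lambda * expR (- (s * y))) / (s - lambda))%:E.
Proof.
move=> l0 AE s0 sl y0.
(* Unlike [1 - h], the function [h] vanishes beyond [y], so that only an integral
   over [[0, y]] remains. *)
pose h (a : R) : R := (1 - expR (- (s * Num.max (y - a) 0)))%R.
have mh : measurable_fun setT h.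
  apply: measurable_funB => //.
  apply: (@measurable_laplace_fun _ _ _ (fun a : R => Num.max (y - a) 0)%R).
  by apply: measurable_maxr => //; exact: measurable_funB.
have m0 (a : R) : (0 <= Num.max (y - a) 0)%R by rewrite le_max lexx orbT.
have h0 a : (0 <= h a)%R.
  by rewrite /h subr_ge0 -expR0 ler_expR oppr_le0 mulr_ge0// ltW.
have h1 a : (h a <= 1)%R by rewrite /h gerBl expR_ge0.
have ih : (distribution P (Borel_of A)).-integrable setT (EFin \o h).
  apply: (le_integrable _ _ _ (integrable_cst_prob (distribution P (Borel_of A)) 1)) => //.
    exact/measurable_EFinP.
  by move=> a _ /=; rewrite lee_fin normr1 ger0_norm.
rewrite ge0_integral_Borel; last 2 first.
- apply/measurable_EFinP.
  apply: (@measurable_laplace_fun _ _ _ (fun a : R => Num.max (y - a) 0)%R).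
  by apply: measurable_maxr => //; exact: measurable_funB.
- by move=> a; rewrite lee_fin expR_ge0.
have -> : (fun a : R => (expR (- (s * Num.max (y - a) 0)))%:E) =
    (fun a => (1 - h a)%:E).
  by apply/funext => a; rewrite /h subKr.
(* On [[0, y]] the density times [h] is [e], with closed-form primitive [G], whose second term needs
   [s != lambda]. *)
pose e (a : R) : R := (lambda * expR (- (lambda * a)) * (1 - expR (- (s * (y - a)))))%R.
pose G (a : R) : R := (- expR (- (lambda * a)) -
  lambda * expR (- (s * y)) * expR ((s - lambda) * a) / (s - lambda))%R.
have hE : \int[distribution P (Borel_of A)]_a (h a)%:E = (G y - G 0)%:E.
  rewrite (@integral_density _ (exponential_pdf lambda))//; last 2 first.
  - exact: measurable_exponential_pdf.
  - by move=> x; apply: exponential_pdf_ge0; exact: ltW.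
  transitivity (\int[mu]_(a in `[0%R, y]) (e a)%:E).
    rewrite [RHS]integral_mkcond/=; apply: eq_integral => a _.
    rewrite patchE; case: ifPn => [/set_mem/=|/negP].
      rewrite in_itv/= => /andP[a0 ay].
      rewrite exponential_pdfE// -EFinM /h max_l ?subr_ge0// mulrC mulNr.
      by [].
    rewrite inE/= in_itv/= => /negP; rewrite negb_and -!ltNge => /orP[a0|ya].
      by rewrite lt0_exponential_pdf// mule0.
    by rewrite /h max_r ?subr_le0 ?(ltW ya)// mulr0 oppr0 expR0 subrr mul0e.
  have [->|yn0] := eqVneq y 0%R.
    by rewrite set_itv1 integral_set1 subrr.
  have dG (x : R) : is_derive x 1%R G (e x).
    have d1 (c : R) : is_derive x 1%R (fun a : R => expR (c * a)) (expR (c * x) * c)%R.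
      have dc : is_derive x 1%R (fun a : R => c * a)%R c.
        by rewrite -[X in is_derive _ _ _ X]mulr1; exact: is_deriveZ.
      exact: (@is_derive1_comp R (@expR R) (fun a : R => c * a)%R).
    have -> : G = (fun a => - expR (- lambda * a) -
        (lambda * expR (- (s * y)) / (s - lambda)) *: expR ((s - lambda) * a))%R.
      by apply/funext => a; rewrite /G /GRing.scale/= mulNr mulrAC.
    have D1 := d1 (- lambda)%R; have D2 := d1 (s - lambda)%R.
    apply: is_derive_eq; rewrite /GRing.scale/= /e.
    have -> : (- (s * (y - x)) = - (s * y) + s * x)%R by ring.
    have -> : ((s - lambda) * x = s * x + - (lambda * x))%R by ring.
    rewrite mulNr !expRD; field.
    by rewrite subr_eq0.
  have cG (x : R) : {for x, continuous G} by exact: is_derive_cont (dG x).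
  apply: (@ge0_FTC2_itvoo _ e G) => //.
  - by rewrite lt_neqAle eq_sym yn0.
  - move=> x _; apply: cvgM.
      apply: cvgMr; apply: expR_cvg; apply: cvgN; apply: cvgMr; exact: cvg_id.
    apply: cvgB; first exact: cvg_cst.
    apply: expR_cvg; apply: cvgN; apply: cvgMr.
    by apply: cvgB; [exact: cvg_cst|exact: cvg_id].
  - move=> x; rewrite in_itv/= => /andP[x0 xy]; rewrite /e mulr_ge0//.
      by rewrite mulr_ge0 ?expR_ge0// ltW.
    by rewrite subr_ge0 -expR0 ler_expR oppr_le0 mulr_ge0 ?subr_ge0 ?ltW.
  - by apply: cvg_at_right_filter; exact: cG.
  - by apply: cvg_at_left_filter; exact: cG.
under eq_integral do rewrite EFinB.
rewrite integralB_EFin//; last exact: integrable_cst_prob.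
rewrite hE integral_cst// -[X in (1 * X)%E]/(distribution P (Borel_of A) setT).
rewrite probability_setT mul1e.
rewrite -EFinB; congr (_%:E); rewrite /G !mulr0 oppr0 expR0.
have -> : ((s - lambda) * y = s * y + - (lambda * y))%R by ring.
rewrite expRD; have := expRxMexpNx_1 (s * y)%R => e1.
have e2 : (expR (- (s * y)) * (expR (s * y) * expR (- (lambda * y))) =
    expR (- (lambda * y)))%R.
  by rewrite mulrA (mulrC (expR (- _))) e1 mul1r.
rewrite -(mulrA lambda) e2; field.
by rewrite subr_eq0.
Qed.

End transform_calculus.

(** * The recursion *)

Section process.
Context {d : measure_display} {T : measurableType d} {R : realType}.
Variable P : probability T R.
Local Notation mu := (@lebesgue_measure R).
Variables (V A B W : nat -> {RV P >-> R}) (lambda w : R).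
Hypothesis lambda_gt0 : 0 < lambda.
Hypothesis w_ge0 : 0 <= w.
Hypothesis V_iid : iid V.
Hypothesis A_iid : iid A.
Hypothesis B_iid : iid B.
Hypothesis VAB_indep : independent_sequences V A B.
Hypothesis V_unif : forall i (E : set R), measurable E ->
  distribution P (V i) E = uniform_prob (@ltr01 R) E.
Hypothesis A_exp : forall i (E : set R), measurable E ->
  distribution P (A i) E = exponential_prob lambda E.
Hypothesis B_ge0 : forall i, {ae P, forall x, 0 <= B i x}.
Hypothesis W0 : forall x, W 0%N x = w.
Hypothesis WS : forall i x, W i.+1 x = Num.max (V i x * W i x + B i x - A i x) 0.

Lemma ae_V_unit k : {ae P, forall x, 0 <= V k x <= 1}.
Proof.
have : {ae P, forall x, ~ (~` `[0, 1]%classic) (V k x)}.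
  apply: ae_law0; first by apply: measurableC; exact: measurable_itv.
  rewrite V_unif; last by apply: measurableC; exact: measurable_itv.
  by rewrite /uniform_prob integral_uniform_pdf setICl integral_set0.
by apply: filterS => x /contrapT; rewrite /= in_itv.
Qed.

Lemma ae_A_ge0 k : {ae P, forall x, 0 <= A k x}.
Proof.
have : {ae P, forall x, ~ `]-oo, 0[%classic (A k x)}.
  apply: ae_law0; first exact: measurable_itv.
  rewrite A_exp; last exact: measurable_itv.
  rewrite /exponential_prob integral0_eq// => x /=; rewrite in_itv/= => x0.
  by rewrite lt0_exponential_pdf.
by apply: filterS => x /negP; rewrite /= in_itv/= -leNgt.
Qed.

Lemma W_ge0 n x : 0 <= W n x.
Proof. by case: n => [|n]; rewrite ?W0// WS le_max lexx orbT. Qed.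

Let PhiB := LST (B 0%N).

Lemma elaplace_service k s : 0 <= s -> elaplace P (B k) s = (PhiB s)%:E.
Proof.
move=> s0; rewrite /PhiB LST_laplace//.
have mB : measurable_fun setT (fun x => Num.max (B 0%N x) 0).
  by apply: measurable_maxr => //; exact: measurable_cst.
rewrite -elaplaceE//; last by move=> x; rewrite le_max lexx orbT.
transitivity (elaplace P (B 0%N) s).
  apply: (@same_law_integral _ _ _ _ _ _ (fun y => (expR (- (s * y)))%:E)).
  - by case: B_iid => _ + D mD; exact.
  - by apply/measurable_EFinP; exact: (@measurable_laplace_fun _ _ _ id).
  - by move=> y; rewrite lee_fin expR_ge0.
apply: ae_eq_integral => //.
- apply/measurable_EFinP; exact: measurable_laplace_fun.
- apply/measurable_EFinP; exact: measurable_laplace_fun.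
- by apply: filterS (B_ge0 0%N) => x Bx _; rewrite max_l.
Qed.

Definition work_transform n s := laplace_prim P (W n) s / s * PhiB s.

Let Y n := workload (W n) (V n) (B n).

Let W_indep n : [/\ indep2 (W n) (V n),
  indep2 (RV_map2 measurable_pair_mul (W n) (V n)) (B n) & indep2 (Y n) (A n)].
Proof.
have nW i : (n, i) \notin window 0 n by rewrite !inE /= ltnn.
have IW : indep_off (inputs V A B) (window 0 n) (W n) by exact: forward_indep.
by have [h1 h2 h3 _] := step_indep IW nW.
Qed.

Lemma elaplace_workload n s : 0 < s -> elaplace P (Y n) s = (work_transform n s)%:E.
Proof.
move=> s0; have [h1 h2 h3] := W_indep n.
transitivity (elaplace P (RV_map2 measurable_pair_mul (W n) (V n)) s *
    elaplace P (B n) s)%E.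
  exact: elaplace_add h2.
rewrite elaplace_service ?ltW// /work_transform EFinM; congr (_ * _)%E.
by apply: elaplace_uniform_mul => //; [exact: W_ge0|exact: V_unif].
Qed.

Lemma ae_workload_ge0 n : {ae P, forall x, 0 <= Y n x}.
Proof.
apply: filterS2 (ae_V_unit n) (B_ge0 n) => x /andP[V0 _] B0.
by rewrite workloadE addr_ge0// mulr_ge0// W_ge0.
Qed.

(** The workload [Y n] is independent of [A n] and almost surely non-negative, so
    [exponential_idle_transform] gives the conditional transform; averaging leaves the transform of
    [Y n] at [s] and at lambda. *)
Lemma laplace_step n s : 0 < s -> s != lambda ->
  (s - lambda) * laplace P (W n.+1) s =
  s * work_transform n lambda - lambda * work_transform n s.
Proof.
move=> s0 sl; have [_ _ h3] := W_indep n.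
have sl0 : s - lambda != 0 by rewrite subr_eq0.
have mg : measurable_fun setT
    (fun z : R * R => (expR (- (s * Num.max (z.1 - z.2) 0)))%:E).
  apply/measurable_EFinP.
  apply: (@measurable_laplace_fun _ _ _ (fun z : R * R => Num.max (z.1 - z.2) 0)).
  exact: measurable_pair_sub_pos.
have g0 (z : R * R) : (0 <= (expR (- (s * Num.max (z.1 - z.2) 0)))%:E)%E.
  by rewrite lee_fin expR_ge0.
have iY t : 0 < t -> P.-integrable setT (fun x => (expR (- (t * Y n x)))%:E).
  move=> t0; apply/integrableP; split.
    by apply/measurable_EFinP; exact: measurable_laplace_fun.
  under eq_integral do rewrite gee0_abs ?lee_fin ?expR_ge0//.
  by rewrite -/(elaplace P (Y n) t) elaplace_workload// ltry.
have LY t : 0 < t -> \int[P]_x expR (- (t * Y n x)) = work_transform n t.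
  by move=> t0; rewrite -[LHS]/(fine (elaplace P (Y n) t)) elaplace_workload.
have E : (elaplace P (W n.+1) s = \int[P]_x ((s * expR (- (lambda * Y n x)) -
    lambda * expR (- (s * Y n x))) / (s - lambda))%:E)%E.
  transitivity (\int[P]_x (expR (- (s * Num.max (Y n x - A n x) 0)))%:E)%E.
    by apply: eq_integral => x _; rewrite WS.
  rewrite (integral_indep2 h3 mg g0) /=.
  have mF := measurable_fun_fubini_tonelli_F (m2 := distribution P (A n)) _ mg g0.
  rewrite ge0_integral_distribution//; last by move=> y; apply: integral_ge0.
  apply: ae_eq_integral => //.
  - by apply: measurableT_comp => //; exact: measurable_funPT.
  - apply/measurable_EFinP; apply: measurable_funM => //.
    have mY t : measurable_fun setT (fun x => expR (- (t * Y n x))).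
      exact: measurable_laplace_fun.
    by apply: measurable_funB; (apply: measurable_funM; [exact: measurable_cst|exact: mY]).
  - apply: filterS (ae_workload_ge0 n) => x Yx _ /=.
    by rewrite (exponential_idle_transform lambda_gt0)//; exact: A_exp.
rewrite laplaceE E -/(Rintegral _ _ _).
have -> : (fun x => (s * expR (- (lambda * Y n x)) -
      lambda * expR (- (s * Y n x))) / (s - lambda)) =
    (fun x => (s - lambda)^-1 * (s * expR (- (lambda * Y n x)) -
      lambda * expR (- (s * Y n x)))).
  by apply/funext => x; rewrite mulrC.
have i1 : P.-integrable setT (EFin \o (fun x => s * expR (- (lambda * Y n x)))).
  exact: (integrableZl _ s (iY lambda lambda_gt0)).
have i2 : P.-integrable setT (EFin \o (fun x => lambda * expR (- (s * Y n x)))).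
  exact: (integrableZl _ lambda (iY s s0)).
rewrite RintegralZl//; last first.
  by have := integrableB measurableT i1 i2.
rewrite RintegralB// !RintegralZl//; [|exact: iY|exact: iY].
by rewrite !LY// mulrA divff// mul1r.
Qed.

(** * Convergence of the backward iterates and passage to the limit *)

Hypothesis B_mean : ('E_P[B 0%N] < +oo)%E.

Let M := backward V A B w 0.

Let inc := increment V B w.

Lemma backward_ge0 k n x : 0 <= backward V A B w k n x.
Proof. by case: n => [|n]; rewrite ?backward0E// backwardSE le_max lexx orbT. Qed.

Lemma increment_ge0 k n x : 0 <= inc k n x.
Proof.
case: n => [|n].
  by rewrite /inc increment0E addr_ge0.
by rewrite /inc incrementSE mulr_ge0.
Qed.

Let ler_dist_max0 (a b : R) : `|Num.max a 0 - Num.max b 0| <= `|a - b|.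
Proof.
have := ler_norm (a - b); have := ler_norm (- (a - b)); rewrite normrN.
set c := `|a - b| => h1 h2; rewrite ler_norml.
by case: (leP a 0) => ha; case: (leP b 0) => hb; apply/andP; split; lra.
Qed.

(** The two iterates share their outer maps and differ only in the value fed to them, [f_(k + n) w]
    against [w]. The positive part is 1-Lipschitz, so each outer map contributes a factor [V]. *)
Lemma backward_increment : {ae P, forall x, forall k n,
  `|backward V A B w k n.+1 x - backward V A B w k n x| <= inc k n x}.
Proof.
have := ae_foralln ae_V_unit; have := ae_foralln ae_A_ge0; have := ae_foralln B_ge0.
apply: filterS3 => x Bx Ax Vx k n; elim: n k => [|n IH] k.
  rewrite backwardSE !backward0E /inc increment0E.
  (* [V <= 1] and [A >= 0] place the first iterate between 0 and [w + B], hence within [w + B] of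
     [w]. *)
  have := Bx k; have := Ax k; have /andP[v0 v1] := Vx k => a0 b0.
  have h1 : V k x * w <= w by rewrite ler_piMl.
  have h2 : 0 <= V k x * w by rewrite mulr_ge0.
  rewrite (ger0_norm w_ge0) (ger0_norm b0) ler_norml; apply/andP; split.
    by rewrite lerBrDr (le_trans (y := 0))// ?le_max ?lexx ?orbT//; lra.
  rewrite lerBlDr ge_max; apply/andP; split; lra.
have h := IH k.+1.
rewrite /inc incrementSE (backwardSE _ _ _ _ _ n.+1) (backwardSE _ _ _ _ k n).
apply: le_trans (ler_dist_max0 _ _) _.
set a := backward _ _ _ _ _ _ _ in h *; set b := backward _ _ _ _ _ _ _ in h *.
have -> : V k x * a + B k x - A k x - (V k x * b + B k x - A k x) = V k x * (a - b).
  by ring.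
by rewrite normrM ler_wpM2l// (le_trans h)// ler_norm.
Qed.

Let mean_abs_B k : (\int[P]_x (`|B k x|)%:E = 'E_P[B 0%N])%E.
Proof.
transitivity (\int[P]_x (`|B 0%N x|)%:E)%E.
  apply: (@same_law_integral _ _ _ _ _ _ (fun y => (`|y|)%:E)).
  - by case: B_iid => _ + D mD; exact.
  - by apply/measurable_EFinP; exact: normr_measurable.
  - by move=> y; rewrite lee_fin.
rewrite unlock; apply: ae_eq_integral => //.
- by apply/measurable_EFinP; exact: measurableT_comp.
- exact/measurable_EFinP.
- by apply: filterS (B_ge0 0%N) => x Bx _; rewrite ger0_norm.
Qed.

Let mean_B_fin : ('E_P[B 0%N] \is a fin_num)%E.
Proof.
rewrite ge0_fin_numE// -(mean_abs_B 0%N).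
by apply: integral_ge0 => x _; rewrite lee_fin.
Qed.

Let mean_abs_V k : (\int[distribution P (V k)]_y (`|y|)%:E = (2^-1)%:E)%E.
Proof.
rewrite integral_uniform_law//; last 2 first.
- exact: V_unif.
- by apply/measurable_EFinP; exact: normr_measurable.
rewrite (@ge0_FTC2_itvoo _ (fun v => `|v|) (fun v => 2^-1 *: (v ^+ 2)) 0 1 0 (2^-1)).
- by rewrite subr0.
- exact: ltr01.
- by move=> v _; exact: norm_continuous.
- by move=> v _; exact: normr_ge0.
- move=> v; rewrite in_itv/= => /andP[v0 _]; rewrite gtr0_norm//.
  apply: is_derive_eq; rewrite /GRing.scale/= mulr1; by field.
- rewrite -[X in _ --> X](mulr0 2^-1); apply: cvgMr.
  rewrite -[X in _ --> X](expr0n R 2); apply: cvg_at_right_filter.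
  exact: exprn_continuous.
- rewrite -[X in _ --> X](mulr1 2^-1); apply: cvgMr.
  rewrite -[X in _ --> X](expr1n R 2); apply: cvg_at_left_filter.
  exact: exprn_continuous.
Qed.

(** [V k] is independent of the later inputs that make up [inc k.+1 n], so each multiplication
    halves the mean. *)
Lemma increment_mean k n :
  (\int[P]_x (inc k n x)%:E = (geometric (w + fine 'E_P[B 0%N]) 2^-1 n)%:E)%E.
Proof.
elim: n k => [|n IH] k /=.
  rewrite expr0 mulr1 EFinD fineK// -(mean_abs_B k).
  transitivity (\int[P]_x (cst w%:E x + (`|B k x|)%:E))%E.
    by apply: eq_integral => x _; rewrite /pair_abs_add /= (ger0_norm w_ge0).
  rewrite ge0_integralD//.
  - rewrite integral_cst// -[X in (w%:E * X)%E]/(P [set: T]).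
    by rewrite probability_setT mule1.
  - by apply/measurable_EFinP; exact: measurableT_comp.
have mg : measurable_fun setT (fun z : R * R => (`|z.2| * `|z.1|)%:E).
  by apply/measurable_EFinP; exact: measurable_pair_abs_mul.
have g0 (z : R * R) : (0 <= (`|z.2| * `|z.1|)%:E)%E by rewrite lee_fin mulr_ge0.
have ind : indep2 (inc k.+1 n) (V k) by exact: (increment_indep2 (A := A)).
transitivity (\int[P]_x (`|V k x| * `|inc k.+1 n x|)%:E)%E; first by [].
rewrite (integral_indep2 ind mg g0) /=.
transitivity (\int[distribution P (inc k.+1 n)]_x ((`|x|)%:E * (2^-1)%:E))%E.
  apply: eq_integral => x _; rewrite -(mean_abs_V k) -ge0_integralZl//.
  - by apply: eq_integral => y _; rewrite mulrC EFinM.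
  - by apply/measurable_EFinP; exact: normr_measurable.
have mn : measurable_fun setT (fun x : R => (`|x|)%:E).
  by apply/measurable_EFinP; exact: normr_measurable.
rewrite ge0_integralZr// ge0_integral_distribution//.
transitivity (\int[P]_x (inc k.+1 n x)%:E * (2^-1)%:E)%E.
  by congr (_ * _)%E; apply: eq_integral => x _ /=; rewrite ger0_norm// increment_ge0.
by rewrite IH -EFinM/= -mulrA -exprSr.
Qed.

(** The means of the increments are summable, so the sum of the increments is almost surely finite
    and the telescoping series converges absolutely. *)
Lemma ae_backward_cvg : {ae P, forall x, cvgn (fun n => M n x)}.
Proof.
have sumE : (\int[P]_x (\sum_(n <oo) (inc 0 n x)%:E) < +oo)%E.
  rewrite integral_nneseries//; last 2 first.
  - by move=> n; exact/measurable_EFinP.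
  - by move=> n x _; rewrite lee_fin increment_ge0.
  under eq_eseriesr do rewrite increment_mean.
  have := @cvg_geometric_series R (w + fine ('E_P[B 0%N])%E) 2^-1.
  rewrite gtr0_norm// invf_lt1// ltr1n => /(_ isT) cg.
  have : (fun n => \sum_(0 <= k < n) (geometric (w + fine 'E_P[B 0%N]) 2^-1 k)%:E)%E @ \oo -->
      ((w + fine 'E_P[B 0%N]) * (1 - 2^-1)^-1)%:E%E.
    under eq_fun do rewrite sumEFin.
    by apply: cvg_EFin; [exact: nearW|exact: cg].
  by move=> /cvg_lim -> //; rewrite ltry.
have isum : P.-integrable setT (fun x => \sum_(n <oo) (inc 0 n x)%:E)%E.
  apply/integrableP; split.
    apply: ge0_emeasurable_sum => // n.
    - by move=> x _; rewrite lee_fin increment_ge0.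
    - by move=> _; exact/measurable_EFinP.
  under eq_integral => x _.
    rewrite gee0_abs; last by apply: nneseries_ge0 => n _ _; rewrite lee_fin increment_ge0.
    over.
  exact: sumE.
have fin := integrable_ae measurableT isum.
apply: filterS2 backward_increment fin => x dM /(_ I) fx.
have inc_cvg : cvgn (series (fun n => inc 0 n x)).
  apply: nondecreasing_is_cvgn.
    apply/nondecreasing_seqP => n.
    by rewrite /series/= big_nat_recr//= lerDl increment_ge0.
  exists (fine (\sum_(n <oo) (inc 0 n x)%:E)%E) => _ [n _ <-].
  rewrite -lee_fin fineK// /series/= -sumEFin.
  by apply: nneseries_lim_ge => k _ _; rewrite lee_fin increment_ge0.
have dcvg : cvgn (series (fun n => M n.+1 x - M n x)).
  apply: normed_cvg.
  apply: (@series_le_cvg _ _ (fun n => inc 0 n x)) => // n.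
  - exact: normr_ge0.
  - exact: increment_ge0.
  - exact: dM.
have -> : (fun n => M n x) = (fun n => w + series (fun n => M n.+1 x - M n x) n).
  apply/funext => n; rewrite /series/= telescope_sumr//.
  by rewrite /M backward0E addrC subrK.
by apply: is_cvgD => //; exact: is_cvg_cst.
Qed.

(** The limit superior is defined and measurable whether or not the iterates converge; [fine] and
    the maximum with 0 make it a non-negative real everywhere and change nothing where they do. *)
Lemma measurable_limit_workload :
  measurable_fun setT (fun x => Num.max (fine (limn_esup (fun n => (M n x)%:E))) 0).
Proof.
apply: measurable_maxr => //; apply: measurableT_comp => //.
by apply: measurable_fun_limn_esup => n; exact/measurable_EFinP.
Qed.

Definition limit_workload : {RV P >-> R} := RV_of P measurable_limit_workload.

Lemma limit_workloadE x :
  limit_workload x = Num.max (fine (limn_esup (fun n => (M n x)%:E))) 0.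
Proof. by []. Qed.

Lemma limit_workload_ge0 x : 0 <= limit_workload x.
Proof. by rewrite limit_workloadE le_max lexx orbT. Qed.

Lemma ae_cvg_limit_workload :
  {ae P, forall x, M n x @[n --> \oo] --> limit_workload x}.
Proof.
apply: filterS ae_backward_cvg => x cM.
have E : (fun n => (M n x)%:E) @ \oo --> (limn (fun n => M n x))%:E.
  by apply: cvg_EFin; [exact: nearW|exact: cM].
have -> : limit_workload x = limn (fun n => M n x).
  rewrite limit_workloadE is_cvg_limn_esupE; last by apply/cvg_ex; eexists; exact: E.
  have -> : limn (fun n => (M n x)%:E) = (limn (fun n => M n x))%:E by exact/cvg_lim.
  rewrite max_l//; apply: limr_ge => //; apply: nearW => n; exact: backward_ge0.
exact: cM.
Qed.

(** Only the law of [W n] matters, so the backward iterate may replace it; almost sure convergence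
    and the bound on [f] then give dominated convergence. *)
Lemma W_cvg_weakly : cvg_weakly W limit_workload.
Proof.
move=> f cf [K fK].
have mf : measurable_fun setT f by exact: continuous_measurable_fun.
have iK : P.-integrable setT (EFin \o cst K) by exact: integrable_cst_prob.
have ib (X : {RV P >-> R}) : P.-integrable setT ((EFin \o f) \o X).
  apply: le_integrable iK => //.
    by apply/measurable_EFinP; exact: measurableT_comp.
  by move=> x _ /=; rewrite lee_fin (le_trans (fK _))// ler_norm.
have -> : (fun n => 'E_P[f \o W n]%E) = (fun n => \int[P]_x (f (M n x))%:E)%E.
  apply/funext => n; rewrite unlock.
  have mEf : measurable_fun setT (EFin \o f) by exact/measurable_EFinP.
  transitivity (\int[distribution P (W n)]_y (f y)%:E)%E.
    by rewrite (integral_distribution mEf (ib (W n))).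
  transitivity (\int[distribution P (M n)]_y (f y)%:E)%E; last first.
    by rewrite (integral_distribution mEf (ib (M n))).
  apply: eq_measure_integral => D mD _.
  exact: same_law_forward_backward.
rewrite unlock.
have [] := @dominated_convergence _ _ _ P setT measurableT
  (fun n x => (f (M n x))%:E) (fun x => (f (limit_workload x))%:E) (EFin \o cst K) => //.
- by move=> n; apply/measurable_EFinP; exact: measurableT_comp.
- by apply/measurable_EFinP; exact: measurableT_comp.
- apply: filterS ae_cvg_limit_workload => x Mx _.
  apply: cvg_EFin; first exact: nearW.
  by apply: cvg_comp Mx _; exact: cf.
- by apply: aeW => x n _ /=; rewrite lee_fin.
Qed.

Lemma laplace_W_cvg s : 0 <= s ->
  laplace P (W n) s @[n --> \oo] --> laplace P limit_workload s.
Proof.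
(* The absolute value makes the test function bounded on the whole line and changes nothing on
   non-negative variables. *)
move=> s0; pose f (x : R) : R := expR (- (s * `|x|)).
have cf : continuous f.
  move=> x; apply: expR_cvg; apply: cvgN; apply: cvgMr.
  exact: norm_continuous.
have f1 (x : R) : `|f x| <= 1.
  by rewrite ger0_norm ?expR_ge0// -expR0 ler_expR oppr_le0 mulr_ge0.
have lE (X : {RV P >-> R}) : (forall x, 0 <= X x) ->
    'E_P[f \o X]%E = (laplace P X s)%:E.
  move=> X0; rewrite unlock -elaplaceE//; apply: eq_integral => x _ /=.
  by rewrite /f ger0_norm.
have := W_cvg_weakly cf (ex_intro _ 1 f1).
rewrite lE; last exact: limit_workload_ge0.
have -> : (fun n => 'E_P[f \o W n]%E) = (fun n => (laplace P (W n) s)%:E).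
  by apply/funext => n; apply: lE; exact: W_ge0.
by move=> /fine_cvg.
Qed.

Lemma laplace_prim_W_cvg s :
  laplace_prim P (W n) s @[n --> \oo] --> laplace_prim P limit_workload s.
Proof.
rewrite /laplace_prim /Rintegral; apply: fine_cvg.
rewrite fineK; last first.
  apply: integrable_fin_num => //.
  by apply: laplace_integrable => //; exact: limit_workload_ge0.
have m1 (X : {RV P >-> R}) : (forall x, 0 <= X x) ->
    measurable_fun `[0, s] (EFin \o laplace P X).
  by move=> X0; apply: (measurable_int mu); exact: laplace_integrable.
have [] := @dominated_convergence _ _ _ mu `[0%R, s]%classic (measurable_itv _)
  (fun n x => (laplace P (W n) x)%:E) (fun x => (laplace P limit_workload x)%:E)
  (EFin \o cst 1) => //.
- by move=> n; apply: m1; exact: W_ge0.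
- by apply: m1; exact: limit_workload_ge0.
- apply: aeW => t /=; rewrite in_itv/= => /andP[t0 _].
  by apply: cvg_EFin; [exact: nearW|exact: laplace_W_cvg].
- by apply: continuous_itvcc_integrable => t _; exact: cvg_cst.
- apply: aeW => t n /=; rewrite in_itv/= => /andP[t0 _].
  by rewrite lee_fin ger0_norm ?laplace_ge0// laplace_le1//; exact: W_ge0.
Qed.

Lemma limit_laplace_eq s : 0 < s ->
  (s - lambda) * laplace P limit_workload s =
  s * (laplace_prim P limit_workload lambda / lambda * PhiB lambda) -
  lambda * PhiB s / s * laplace_prim P limit_workload s.
Proof.
move=> s0.
have -> : lambda * PhiB s / s * laplace_prim P limit_workload s =
    lambda * (laplace_prim P limit_workload s / s * PhiB s) by ring.
(* [laplace_step] excludes [s = lambda]; there both sides vanish, the constant [p] being read off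
   the last term at lambda. *)
have [->|sl] := eqVneq s lambda; first by rewrite subrr mul0r subrr.
have h1 : (s - lambda) * laplace P (W n.+1) s @[n --> \oo] -->
    (s - lambda) * laplace P limit_workload s.
  apply: cvgMr.
  by have := laplace_W_cvg (ltW s0); rewrite -(cvg_shiftS (fun n => laplace P (W n) s)).
have wt t : work_transform n t @[n --> \oo] -->
    laplace_prim P limit_workload t / t * PhiB t.
  by apply: cvgMl; apply: cvgMl; exact: laplace_prim_W_cvg.
have h2 : (s - lambda) * laplace P (W n.+1) s @[n --> \oo] -->
    s * (laplace_prim P limit_workload lambda / lambda * PhiB lambda) -
    lambda * (laplace_prim P limit_workload s / s * PhiB s).
  under eq_fun do rewrite laplace_step//.
  by apply: cvgB; apply: cvgMr; exact: wt.
exact: cvg_unique h1 h2.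
Qed.

Lemma limit_transform_formula s : 0 < s -> s != lambda ->
  LST limit_workload s =
    p_infty lambda PhiB / (s - lambda) *
    (s - lambda * PhiB s / s *
      oint lambda s (fun u => u / (u - lambda) *
        expR (lambda * oint u s (fun t => PhiB t / (t * (lambda - t)))))).
Proof.
move=> s0 sl.
have L0 := limit_workload_ge0.
have mL : measurable_fun setT limit_workload by exact: measurable_funPT.
have -> : LST limit_workload = laplace P limit_workload.
  rewrite LST_laplace; last exact: aeW.
  by congr (laplace P _); apply/funext => x; rewrite max_l.
pose B' x := Num.max (B 0%N x) 0.
have mB' : measurable_fun setT B' by apply: measurable_maxr => //; exact: measurable_cst.
have B'0 x : 0 <= B' x by rewrite le_max lexx orbT.
have PhiBE : PhiB = laplace P B' by exact: LST_laplace.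
have EB' : (\int[P]_x (B' x)%:E < +oo)%E.
  move: B_mean; rewrite -(mean_abs_B 0%N); congr (_ < _)%E.
  apply: ae_eq_integral => //.
  - by apply/measurable_EFinP; exact: measurableT_comp.
  - exact/measurable_EFinP.
  - by apply: filterS (B_ge0 0%N) => x Bx _; rewrite ger0_norm// /B' max_l.
apply: (@ode_formula R lambda
  (laplace_prim P limit_workload lambda / lambda * PhiB lambda)
  (fine (\int[P]_x (B' x)%:E)%E) (laplace P limit_workload) PhiB
  (laplace_prim P limit_workload)) => //.
- by move=> t t0; rewrite PhiBE; exact: laplace_continuous.
- by move=> t t0; rewrite PhiBE; apply: laplace_gt0 => //; exact: ltW.
- by move=> t t0; rewrite PhiBE; apply: laplace_le1 => //; exact: ltW.
- by move=> t u t0 tu; rewrite PhiBE; apply: laplace_nincr => //; exact: ltW.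
- by move=> t t0; rewrite PhiBE; apply: laplace_mean => //; exact: ltW.
- by move=> t t0; exact: is_derive_laplace_prim.
- move=> t t0; have /andP[h1 ->] := laplace_prim_bound P mL L0 (ltW t0).
  rewrite andbT; apply: lt_le_trans h1.
  by rewrite mulr_gt0// laplace_gt0// ltW.
- exact: laplace_prim_slope0.
- by move=> t t0; exact: limit_laplace_eq.
Qed.

End process.

Theorem theorem10 (R : realType) (d : measure_display) (T : measurableType d)
    (P : probability T R) (V A B W : nat -> {RV P >-> R}) (lambda w : R)
    (lambda_gt0 : 0 < lambda) (w_ge0 : 0 <= w)
    (V_iid : iid V) (A_iid : iid A) (B_iid : iid B)
    (VAB_indep : independent_sequences V A B)
    (V_unif : forall i (E : set R), measurable E ->
       distribution P (V i) E = uniform_prob (@ltr01 R) E)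
    (A_exp : forall i (E : set R), measurable E ->
       distribution P (A i) E = exponential_prob lambda E)
    (B_ge0 : forall i, {ae P, forall x, 0 <= B i x})
    (B_mean : ('E_P[B 0%N] < +oo)%E)
    (W0 : forall x, W 0%N x = w)
    (WS : forall i x, W i.+1 x = Num.max (V i x * W i x + B i x - A i x) 0) :
  exists (d' : measure_display) (T' : measurableType d')
      (Q : probability T' R) (Winf : {RV Q >-> R}),
    cvg_weakly W Winf /\
    forall s : R, 0 < s -> s != lambda ->
      LST Winf s =
        p_infty lambda (LST (B 0%N)) / (s - lambda) *
        (s - lambda * LST (B 0%N) s / s *
           oint lambda s (fun u => u / (u - lambda) *
             expR (lambda * oint u s (fun t =>
               LST (B 0%N) t / (t * (lambda - t)))))).
Proof.
exists d, T, P, (limit_workload V A B w); split.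
  exact: (W_cvg_weakly (lambda := lambda)).
by move=> s s0 sl; exact: limit_transform_formula.
Qed.
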